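(* There exists a Jordan curve $\gamma$ separating $0$ from $\infty$ such that $$\mathcal H^*(\gamma)<\mathcal H(\rho^\gamma_{\mathrm{eq.}}),$$ where $\rho^\gamma_{\mathrm{eq.}}$ is the driving measure of the equipotential foliation corresponding to $\gamma$.
   Context: $S^1=[0,2\pi)$ is identified with the unit circle; $\mathbb D$ is the unit disc, $\Delta=\{|z|>1\}\cup\{\infty\}$. $\mathcal N$ is the set of Borel measures $\mu$ on $S^1\times\mathbb R$ with $\mu(S^1\times I)=|I|$ for every interval $I\subset\mathbb R$; by disintegration $\rho(d\theta,dt)=\rho_t(d\theta)dt$ with $\rho_t$ probability measures. Entropy: $\mathcal H(\rho)=\frac1{2\pi}\iint_{S^1\times\mathbb R}\bar\rho_t\log\bar\rho_t\,d\theta dt$ if $\rho=\bar\rho_t(\theta)d\theta dt/2\pi$ and the integral is defined, and $+\infty$ otherwise. Whole-plane Loewner chain: $\rho\in\mathcal N$ determines conformal maps $f_t:\Delta\to\Delta_t=\hat{\mathbb C}\smallsetminus K_t$, $t\in\mathbb R$, with $f_t(z)=e^tz+O(1)$ as $z\to\infty$, solving (in the integrated sense in $t$) $\dot f_t(z)=zf_t'(z)p_t(z)$, $p_t(z)=\int_0^{2\pi}\frac{z+e^{i\theta}}{z-e^{i\theta}}\rho_t(d\theta)$, with $\lim_{t\to-\infty}e^tf_t^{-1}(z)=z$ for $z\in\mathbb C\smallsetminus\{0\}$. For a Jordan curve $\gamma$ separating $0$ from $\infty$ of capacity $e^T$, $\rho$ generates $\gamma$ if $\partial\Delta_T=\gamma$.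 The minimal entropy is $\mathcal H^*(\gamma)=\inf\{\mathcal H(\rho):\rho\in\mathcal N\text{ generates }\gamma\}$. Equipotential foliation: let $D$ be the bounded component of $\mathbb C\smallsetminus\gamma$, $f:\mathbb D\to D$ the conformal map with $f(0)=0$, $f'(0)>0$, and $g:\Delta\to\hat{\mathbb C}\smallsetminus\overline D$ the conformal map with $g(\infty)=\infty$ and positive derivative there. The sets $f(r\overline{\mathbb D})$, $0<r<1$, then $\overline D$, then $\hat{\mathbb C}\smallsetminus g(\{|z|>R\}\cup\{\infty\})$, $R>1$, form an increasing family of compact hulls, which when parametrized so that the hull at time $t\in\mathbb R$ has capacity $e^t$ is a whole-plane Loewner chain; $\rho^\gamma_{\mathrm{eq.}}\in\mathcal N$ is its driving measure (for $t$ larger than the time at which $\gamma$ is generated it equals $d\theta dt/2\pi$). *)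

(* Defs.v *)
From HB Require Import structures.
From mathcomp Require Import all_boot all_order all_algebra.
From mathcomp Require Import all_classical all_reals all_analysis.
From mathcomp.real_closed Require Import complex.
Set Implicit Arguments.
Unset Strict Implicit.
Unset Printing Implicit Defensive.
Import Order.TTheory GRing.Theory Num.Theory.
Import numFieldNormedType.Exports.
Local Open Scope ring_scope.
Local Open Scope complex_scope.
Local Open Scope classical_set_scope.

(* R[i]^o is the complex field with its usual topology, as a normed space over
   itself: derivability in direction 1 is complex differentiability, and
   0 < z means that z is real and positive. *)
Notation Cplx R := (R[i]^o).

Section ComplexAnalysis.
Context {R : realType}.
Local Notation C := (Cplx R).

(* A conformal map with pole at oo is represented by its restriction to finite
   points: the exterior disc is taken without oo, and f(oo) = oo with
   derivative c at oo is expressed by f z = c z + O(1). *)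
Definition unit_disc : set C := [set z | `|z| < 1].
Definition exterior_disc : set C := [set z | 1 < `|z|].

Definition expi (x : R) : C := cos x +i* sin x.

Definition conformal (U V : set C) (f : C -> C) : Prop :=
  (forall z, U z -> derivable f z 1) /\ set_bij U V f.

Definition linear_at_infinity (c : R) (f : C -> C) : Prop :=
  exists M r : R, forall z : C, r%:C < `|z| -> `|f z - c%:C * z| <= M%:C.

(* Conformal from Delta onto the complement of K in the sphere, normalized at
   oo, so that K has capacity c. *)
Definition exterior_map (c : R) (K : set C) (g : C -> C) : Prop :=
  [/\ 0 < c, conformal exterior_disc (~` K) g & linear_at_infinity c g].

Definition has_capacity (K : set C) (c : R) : Prop :=
  exists g, exterior_map c K g.

Definition topological_boundary (A : set C) : set C := closure A `\` interior A.

Definition cintegral d (T : measurableType d)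
    (mu : {measure set T -> \bar R}) (D : set T) (f : T -> C) : C :=
  (\int[mu]_(x in D) complex.Re (f x)) +i* (\int[mu]_(x in D) complex.Im (f x)).

Definition cintegrable d (T : measurableType d)
    (mu : {measure set T -> \bar R}) (D : set T) (f : T -> C) : Prop :=
  mu.-integrable D (fun x => (complex.Re (f x))%:E) /\
  mu.-integrable D (fun x => (complex.Im (f x))%:E).

Definition jordan_curve (gamma : set C) : Prop :=
  exists phi : R -> C,
    [/\ {within `[0, 2 * pi], continuous phi},
        phi 0 = phi (2 * pi),
        {in `[0, 2 * pi[ &, injective phi}
      & gamma = phi @` `[0, 2 * pi[ ].

(* For a Jordan curve separating 0 from oo this is the bounded component of
   the complement. *)
Definition inner_domain (gamma : set C) : set C :=
  connected_component (~` gamma) 0.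

Definition separates_0_infty (gamma : set C) : Prop :=
  ~ gamma 0 /\ bounded_set (inner_domain gamma).

End ComplexAnalysis.

Section LoewnerChains.
Context {R : realType}.
Local Notation C := (Cplx R).
Local Notation Rm := (measurableTypeR R).
Local Notation leb := (@lebesgue_measure R).
Local Notation leb2 := (@lebesgue_measure R \x @lebesgue_measure R)%E.

Definition circle : set Rm := `[0, 2 * pi[.
Definition cylinder : set (Rm * Rm) := circle `*` setT.

(* The class N. Points of S^1 x R are pairs (theta, t); a measure on the
   cylinder is a measure on the plane not charging its complement. *)
Definition loewner_class (rho : {measure set (Rm * Rm) -> \bar R}) : Prop :=
  rho (~` cylinder) = 0%E /\
  forall I : interval R, rho (circle `*` [set` I]) = leb [set` I].

(* rho(dtheta, dt) = k_t(dtheta) dt *)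
Definition disintegration (rho : {measure set (Rm * Rm) -> \bar R})
    (k : R.-pker Rm ~> Rm) : Prop :=
  (forall t, k t circle = 1%E) /\
  forall A, measurable A -> rho A = (\int[leb]_t k t (ysection A t))%E.

Definition is_density (rho : {measure set (Rm * Rm) -> \bar R})
    (d : Rm * Rm -> R) : Prop :=
  [/\ measurable_fun setT d, forall x, 0 <= d x
    & forall A, measurable A ->
        rho A = (\int[leb2]_(x in A `&` cylinder) (d x / (2 * pi))%:E)%E].

Definition entropy_integrand (d : Rm * Rm -> R) (x : Rm * Rm) : \bar R :=
  (d x * ln (d x))%:E.

(* The positive and negative parts do not both have infinite integral. *)
Definition entropy_integral_defined (d : Rm * Rm -> R) : Prop :=
  ((\int[leb2]_(x in cylinder) (entropy_integrand d)^\+ x) +?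
   (- \int[leb2]_(x in cylinder) (entropy_integrand d)^\- x))%E.

(* Densities agree a.e. on the cylinder, so the one picked is irrelevant. *)
Definition entropy (rho : {measure set (Rm * Rm) -> \bar R}) : \bar R :=
  let d := get (is_density rho) in
  if `[< is_density rho d /\ entropy_integral_defined d >]
  then (((2 * pi)^-1)%:E * \int[leb2]_(x in cylinder) entropy_integrand d x)%E
  else +oo%E.

Definition herglotz (k : R.-pker Rm ~> Rm) (t : R) (z : C) : C :=
  cintegral (k t) circle (fun theta => (z + expi theta) / (z - expi theta)).

Definition hull (f : C -> C) : set C := ~` (f @` exterior_disc).

Definition whole_plane_chain (rho : {measure set (Rm * Rm) -> \bar R})
    (F : R -> C -> C) : Prop :=
  exists k : R.-pker Rm ~> Rm,
  [/\ disintegration rho k,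
      forall t, exterior_map (expR t) (hull (F t)) (F t),
      forall (z : C) (s t : R), exterior_disc z -> s <= t ->
        let v := fun u : Rm => z * 'D_1 (F u) z * herglotz k u z in
        cintegrable leb `[s, t] v /\
        F t z - F s z = cintegral leb `[s, t] v
    & forall z : C, z != 0 ->
        (\forall t \near -oo, (F t @` exterior_disc) z) /\
        ((expR t)%:C * 'pinv_(fun=> 0) exterior_disc (F t) z)
          @[t --> -oo] --> z].

Definition generates (rho : {measure set (Rm * Rm) -> \bar R})
    (gamma : set C) : Prop :=
  exists (T : R) (F : R -> C -> C),
    [/\ has_capacity (closure (inner_domain gamma)) (expR T),
        whole_plane_chain rho F
      & topological_boundary (F T @` exterior_disc) = gamma].

Definition minimal_entropy (gamma : set C) : \bar R :=
  ereal_inf [set entropy rho |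
    rho in [set rho | loewner_class rho /\ generates rho gamma]].

Definition interior_uniformization (gamma : set C) (f : C -> C) : Prop :=
  [/\ conformal unit_disc (inner_domain gamma) f, f 0 = 0 & 0 < 'D_1 f 0].

Definition exterior_uniformization (gamma : set C) (g : C -> C) : Prop :=
  exists c, exterior_map c (closure (inner_domain gamma)) g.

Definition equipotential_hulls (gamma : set C) (f g : C -> C) : set (set C) :=
  [set K | [\/ exists2 r : R, 0 < r < 1 & K = f @` [set z : C | `|z| <= r%:C],
               K = closure (inner_domain gamma)
             | exists2 r : R, 1 < r & K = ~` (g @` [set z : C | r%:C < `|z|])]].

(* The normalization F_t(z) = e^t z + O(1) makes the hull at time t the
   equipotential hull of capacity e^t. *)
Definition equipotential_measure (gamma : set C)
    (rho : {measure set (Rm * Rm) -> \bar R}) : Prop :=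
  loewner_class rho /\
  exists (f g : C -> C) (F : R -> C -> C),
    [/\ interior_uniformization gamma f,
        exterior_uniformization gamma g,
        whole_plane_chain rho F
      & range (fun t => hull (F t)) = equipotential_hulls gamma f g].

End LoewnerChains.

(* Main.v *)
Require Import Defs.
From HB Require Import structures.
From mathcomp Require Import all_boot all_order all_algebra.
From mathcomp Require Import all_classical all_reals all_analysis.
From mathcomp Require Import measurable_realfun.
From mathcomp.real_closed Require Import complex.
From mathcomp Require Import ring lra.
Set Implicit Arguments.
Unset Strict Implicit.
Unset Printing Implicit Defensive.
Import Order.TTheory GRing.Theory Num.Theory.
Import numFieldNormedType.Exports.
Local Open Scope ring_scope.
Local Open Scope complex_scope.
Local Open Scope classical_set_scope.

(* Take a circle |z - b| = 1 with 0 < b < 1. Every chain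
   F_t(z) = e^t z + C(t) with C' = a e^t, 0 <= a <= 1, foliates by circles and
   is driven by the density 1 + a(t) cos(theta); the equipotential foliation is
   one of these. Write a = 2 beta / (1 + beta^2); by the Poisson kernel the
   entropy of the chain is the integral over t of h(a(t)), where h is strictly
   convex and h'(a) = beta. As the center must run from 0 to b until time 0,
   the integral of a(t) e^t is prescribed, so by the tangent inequality the
   profile with beta(t) = l e^t strictly beats every other one, among them the
   equipotential one. The parametrization b = ln(1 + l^2) / l makes both
   profiles explicit. *)

(** For [F_t(z) = e^t z + c(t)] with [c' = a e^t] the Loewner equation reads [p_t(z) = 1 + a / z],
    which singles out the density [1 + a cos]; its positivity is the condition [a <= 1]. The
    equipotential curves inside the off-center disc are circles because its Riemann map is a Moebius
    map; outside they are concentric, so [a = 0] after time 0. The choice [beta = l e^t] is the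
    Lagrange condition: the constraint fixes the integral of [a e^t], so [h'(a)] has to be
    proportional to [e^t]. The comparison itself never differentiates [h]: the tangent inequality
    for [x ln x] is applied pointwise on the cylinder, and only its linear term, whose mean over a
    circle is [beta] times the difference of the profiles, is integrated exactly. A common bound
    [m < 1] on both profiles keeps the logarithms bounded, and decay like [e^t] at -oo makes the
    integrals over infinite time finite. *)

Section ComplexPlane.
Context {R : realType}.
Local Notation C := (Cplx R).
Local Notation Re := complex.Re.
Local Notation Im := complex.Im.

(** Norms in [R[i]] are complex numbers with zero imaginary part; squaring turns disc conditions
    into real polynomial inequalities for [nra]. *)
Lemma ltc_normP (z : C) (r : R) : 0 <= r ->
  (`|z| < r%:C) = (Re z ^+ 2 + Im z ^+ 2 < r ^+ 2).
Proof.
move=> r0; rewrite (_ : `|z| = (Num.sqrt (Re z ^+ 2 + Im z ^+ 2))%:C) ?normc_def//.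
rewrite ltcR -{1}(ger0_norm r0) -sqrtr_sqr.
have [->|r1] := eqVneq r 0.
  rewrite expr0n/= sqrtr0 !ltNge sqrtr_ge0/=.
  by rewrite addr_ge0// sqr_ge0.
by rewrite ltr_sqrt// exprn_even_gt0.
Qed.

Lemma lec_normP (z : C) (r : R) : 0 <= r ->
  (`|z| <= r%:C) = (Re z ^+ 2 + Im z ^+ 2 <= r ^+ 2).
Proof.
move=> r0; rewrite (_ : `|z| = (Num.sqrt (Re z ^+ 2 + Im z ^+ 2))%:C) ?normc_def//.
rewrite lecR -{1}(ger0_norm r0) -sqrtr_sqr.
by rewrite ler_sqrt// sqr_ge0.
Qed.

Lemma gtc_normP (z : C) (r : R) : 0 <= r ->
  (r%:C < `|z|) = (r ^+ 2 < Re z ^+ 2 + Im z ^+ 2).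
Proof.
move=> r0; rewrite (_ : `|z| = (Num.sqrt (Re z ^+ 2 + Im z ^+ 2))%:C) ?normc_def//.
rewrite ltcR ltNge [RHS]ltNge; congr negb.
have := lec_normP z r0.
by rewrite (_ : `|z| = (Num.sqrt (Re z ^+ 2 + Im z ^+ 2))%:C) ?normc_def// lecR.
Qed.

Lemma cReD (z w : C) : Re (z + w) = Re z + Re w. Proof. by case: z; case: w. Qed.
Lemma cImD (z w : C) : Im (z + w) = Im z + Im w. Proof. by case: z; case: w. Qed.
Lemma cReB (z w : C) : Re (z - w) = Re z - Re w. Proof. by case: z; case: w. Qed.
Lemma cImB (z w : C) : Im (z - w) = Im z - Im w. Proof. by case: z; case: w. Qed.
Lemma cReM (z w : C) : Re (z * w) = Re z * Re w - Im z * Im w.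
Proof. by case: z; case: w. Qed.
Lemma cImM (z w : C) : Im (z * w) = Re z * Im w + Im z * Re w.
Proof. by case: z; case: w. Qed.
Lemma complex_ext (z w : C) : Re z = Re w -> Im z = Im w -> z = w.
Proof. by case: z => a b; case: w => c d /= -> ->. Qed.

Lemma complex_cvg_ReIm (T : Type) (F : set_system T) (FF : Filter F)
    (f : T -> C) (z : C) :
  Re (f x) @[x --> F] --> Re z -> Im (f x) @[x --> F] --> Im z ->
  f x @[x --> F] --> z.
Proof.
move=> /cvgrPdist_lt hr /cvgrPdist_lt hi; apply/cvgrPdist_lt => e.
(* A positive radius in [R[i]] is real; half of it in each coordinate is enough, the two squares
   adding up to less than [e1 ^+ 2]. *)
case: e => e1 e2; rewrite ltcE /= => /andP[/eqP -> e0].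
have e20 : 0 < e1 / 2 by rewrite divr_gt0.
near=> x.
have h1 : `|Re z - Re (f x)| < e1 / 2 by near: x; exact: hr.
have h2 : `|Im z - Im (f x)| < e1 / 2 by near: x; exact: hi.
rewrite (@ltc_normP (z - f x) e1 (ltW e0)) cReB cImB.
move: h1 h2; rewrite !ltr_norml; move: (Re z - _) (Im z - _) => p q.
by move=> /andP[? ?] /andP[? ?]; nra.
Unshelve. all: by end_near. Qed.

Lemma Re_continuous : continuous (@complex.Re R : C -> R).
Proof.
move=> z; apply/(@cvgrPdist_lt _ _ _ (nbhs (z : C))) => e e0.
have : nbhs z (ball z e%:C) by apply: nbhsx_ballx; rewrite ltcR.
apply: filterS => w; rewrite /ball/=.
rewrite (@ltc_normP _ e (ltW e0)) -cReB => h.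
rewrite ltr_norml; move: (Re _) (Im _) h => p q h; apply/andP; split; nra.
Qed.

Lemma Im_continuous : continuous (@complex.Im R : C -> R).
Proof.
move=> z; apply/(@cvgrPdist_lt _ _ _ (nbhs (z : C))) => e e0.
have : nbhs z (ball z e%:C) by apply: nbhsx_ballx; rewrite ltcR.
apply: filterS => w; rewrite /ball/=.
rewrite (@ltc_normP _ e (ltW e0)) -cImB => h.
rewrite ltr_norml; move: (Re _) (Im _) h => p q h; apply/andP; split; nra.
Qed.

(** All circles involved have real centers, so [c] is real. The squared distance is polynomial, and
    discs, exteriors and circles become its sublevel, superlevel and level sets. *)
Definition sqdist (c : R) (z : C) : R := (Re z - c) ^+ 2 + Im z ^+ 2.

Lemma sqdist_continuous c : continuous (sqdist c).
Proof.
have -> : sqdist c = fun z => (Re z - c) * (Re z - c) + Im z * Im z.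
  by apply/funext => z; rewrite /sqdist !expr2.
have cR z : Re x - c @[x --> nbhs (z : C)] --> Re z - c.
  by apply: (@cvgB _ _ C (nbhs z)); [exact: Re_continuous|exact: cvg_cst].
move=> z; apply: (@cvgD _ _ C (nbhs z)); apply: (@cvgM R C (nbhs z)) => //.
all: exact: Im_continuous.
Qed.

Lemma sqdist_open_lt c r : open [set z | sqdist c z < r].
Proof.
rewrite (_ : mkset _ = sqdist c @^-1` [set x | x < r])//.
by apply: (continuousP _).1; [exact: sqdist_continuous|exact: open_lt].
Qed.

Lemma sqdist_open_gt c r : open [set z | r < sqdist c z].
Proof.
rewrite (_ : mkset _ = sqdist c @^-1` [set x | r < x])//.
by apply: (continuousP _).1; [exact: sqdist_continuous|exact: open_gt].
Qed.

Lemma sqdist_closed_le c r : closed [set z | sqdist c z <= r].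
Proof.
rewrite (_ : mkset _ = sqdist c @^-1` [set x | x <= r])//.
by apply: (continuous_closedP _).1; [exact: sqdist_continuous|exact: closed_le].
Qed.

Lemma sqdist_closed_ge c r : closed [set z | r <= sqdist c z].
Proof.
rewrite (_ : mkset _ = sqdist c @^-1` [set x | r <= x])//.
by apply: (continuous_closedP _).1; [exact: sqdist_continuous|exact: closed_ge].
Qed.

(** Seen as a path in the factor [s], it runs along the ray from [c] through [z]: it approaches
    boundary points in the closure lemmas and joins 0 to the points of a disc. *)
Definition homothety (c : R) (z : C) (s : R) : C :=
  (c + s * (Re z - c)) +i* (s * Im z).

Lemma homothety1 c z : homothety c z 1 = z.
Proof. by apply: complex_ext => /=; ring. Qed.

Lemma homothety_continuous c z : continuous (homothety c z).
Proof.
move=> s; apply: complex_cvg_ReIm => /=.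
  apply: cvgD; first exact: cvg_cst.
  by apply: cvgMl; exact: cvg_id.
by apply: cvgMl; exact: cvg_id.
Qed.

Lemma sqdist_homothety c z s :
  sqdist c (homothety c z s) = s ^+ 2 * sqdist c z.
Proof. by rewrite /sqdist/=; ring. Qed.

(** Each point of the closed disc is the limit, as [s] tends to 1 from below, of its contractions
    toward the center, which lie strictly inside. *)
Lemma closure_disc c r : 0 < r ->
  closure [set z | sqdist c z < r] = [set z | sqdist c z <= r].
Proof.
move=> r0; apply/seteqP; split.
  rewrite [X in _ `<=` X](iffLR (closure_id _) (@sqdist_closed_le c r)).
  by apply: closure_subset => z /= /ltW.
move=> z /= zr B zB.
have h : \forall s \near (1:R)^'-, B (homothety c z s).
  have : homothety c z s @[s --> (1:R)^'-] --> homothety c z 1.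
    by apply: cvg_at_left_filter; exact: homothety_continuous.
  by rewrite homothety1; apply.
near (1:R)^'- => s; exists (homothety c z s); split; last by near: s.
rewrite /= sqdist_homothety.
have s1 : s < 1 by near: s; exact: nbhs_left_lt.
have s0 : 0 < s by near: s; apply: nbhs_left_gt.
have s2 : s ^+ 2 < 1 by rewrite expr_lt1// ltW.
by apply: (@le_lt_trans _ _ (s ^+ 2 * r)); [rewrite ler_pM2l ?exprn_gt0|nra].
Unshelve. all: by end_near. Qed.

(** The same argument with dilations, [s] tending to 1 from above; [0 < r] keeps the center, which
    dilations fix, out of the set. *)
Lemma closure_exterior c r : 0 < r ->
  closure [set z | r < sqdist c z] = [set z | r <= sqdist c z].
Proof.
move=> r0; apply/seteqP; split.
  rewrite [X in _ `<=` X](iffLR (closure_id _) (@sqdist_closed_ge c r)).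
  by apply: closure_subset => z /= /ltW.
move=> z /= zr B zB.
have h : \forall s \near (1:R)^'+, B (homothety c z s).
  have : homothety c z s @[s --> (1:R)^'+] --> homothety c z 1.
    by apply: cvg_at_right_filter; exact: homothety_continuous.
  by rewrite homothety1; apply.
near (1:R)^'+ => s; exists (homothety c z s); split; last by near: s.
rewrite /= sqdist_homothety.
have s1 : 1 < s by near: s; exact: nbhs_right_gt.
have s2 : 1 < s ^+ 2 by rewrite expr_gt1// (le_trans ler01) ?ltW.
by apply: (@lt_le_trans _ _ (s ^+ 2 * r)); [nra|rewrite ler_pM2l//; lra].
Unshelve. all: by end_near. Qed.

Lemma exterior_boundary c r : 0 < r ->
  topological_boundary [set z | r < sqdist c z] = [set z | sqdist c z = r].
Proof.
move=> r0; rewrite /topological_boundary closure_exterior//.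
rewrite (_ : interior _ = [set z | r < sqdist c z]); last exact/interior_id/sqdist_open_gt.
apply/seteqP; split => z /=.
  by case=> h1 /negP; rewrite -leNgt => h2; apply/eqP; rewrite eq_le h1 h2.
by move=> ->; split=> //; rewrite ltxx.
Qed.

(* The disc is the union of the segments joining its points to 0. *)
Lemma inner_domain_circle c r : c ^+ 2 < r ->
  inner_domain [set z : C | sqdist c z = r] = [set z | sqdist c z < r].
Proof.
move=> cr; have d0 : sqdist c 0 < r by rewrite /sqdist/=; nra.
apply/seteqP; split => z.
  (* The part of [B] in the open disc is relatively open, and relatively closed because [B] misses
     the circle; by connectedness it is all of [B]. *)
  case=> B [B0 BA cB] Bz; suff : B `&` [set z | sqdist c z < r] = B.
    by move=> h; move: Bz; rewrite -{1}h => -[].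
  apply: cB; first by exists 0.
    by exists [set z | sqdist c z < r] => //; exact: sqdist_open_lt.
  exists [set z | sqdist c z <= r]; first exact: sqdist_closed_le.
  apply/seteqP; split => w [Bw /= wr]; split => //=; first exact: ltW.
  rewrite lt_neqAle wr andbT; apply/eqP => h; exact: (BA w Bw).
move=> zr; exists (homothety 0 z @` `[0, 1]); last first.
  by exists 1; rewrite ?homothety1//= in_itv/= lexx ler01.
split.
- exists 0; first by rewrite /= in_itv/= lexx ler01.
  by apply: complex_ext => /=; ring.
- move=> _ [s /= + <-]; rewrite in_itv/= => /andP[s0 s1].
  move: zr d0; rewrite /sqdist/= => zr d0 h.
  move: zr d0 h; move: (Re z) (Im z) => x y zr d0 h.
  suff : (s * x - c) ^+ 2 + (s * y) ^+ 2 < r by lra.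
  (* Convexity along the segment, made exact. Strictness comes from the term in [c] when [s < 1] and
     from the hypothesis on [z] when [s = 1]. *)
  have -> : (s * x - c) ^+ 2 + (s * y) ^+ 2 =
     s * ((x - c) ^+ 2 + y ^+ 2) + (1 - s) * c ^+ 2
       - s * (1 - s) * (x ^+ 2 + y ^+ 2) by ring.
  have h1 : 0 <= s * (1 - s) * (x ^+ 2 + y ^+ 2).
    by rewrite !mulr_ge0// ?subr_ge0// addr_ge0// sqr_ge0.
  have [s1'|s1'] := ltP s 1.
    have : 0 < (1 - s) * (r - c ^+ 2) by rewrite mulr_gt0 ?subr_gt0//; lra.
    have : 0 <= s * (r - ((x - c) ^+ 2 + y ^+ 2)).
      by rewrite mulr_ge0// subr_ge0 ltW.
    lra.
  have -> : s = 1 by apply/eqP; rewrite eq_le s1 s1'.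
  lra.
- apply: connected_continuous_connected.
    exact/connected_intervalP/interval_is_interval.
  by apply: continuous_subspaceT; exact: homothety_continuous.
Qed.

End ComplexPlane.

(** * Circles under affine and Moebius maps *)

Section Circles.
Context {R : realType}.
Local Notation C := (Cplx R).
Local Notation Re := complex.Re.
Local Notation Im := complex.Im.

(** Equal cosines and sines force [cos (y - x) = 1], that is [sin ((y - x) / 2) = 0], which fails
    when the half difference lies strictly between 0 and pi. *)
Lemma expi_inj : {in `[0, 2 * pi[ &, injective (@expi R)}.
Proof.
have aux (x y : R) : 0 <= x -> y < 2 * pi -> x < y -> expi x = expi y -> False.
  move=> x0 y2 xy [cxy sxy].
  have /eqP : cos (y - x) = 1 by rewrite cosB -cxy -sxy -!expr2 cos2Dsin2.
  have -> : y - x = ((y - x) / 2) *+ 2 by rewrite -mulr_natr; field.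
  rewrite cos_mulr2n cos2sin2.
  have : 0 < sin ((y - x) / 2) by apply: sin_gt0_pi; apply/andP; split; lra.
  move: (sin _) => s s0; have : 0 < s ^+ 2 by rewrite exprn_gt0.
  by rewrite -mulr_natr => s2 /eqP; lra.
move=> x y; rewrite !inE/= !in_itv/= => /andP[x0 x2] /andP[y0 y2] e.
by have [xy|yx|//] := ltgtP x y; [case: (aux x y)|case: (aux y x)].
Qed.

Lemma expi_surj (x y : R) : x ^+ 2 + y ^+ 2 = 1 ->
  exists2 t, 0 <= t < 2 * pi & cos t = x /\ sin t = y.
Proof.
move=> xy; have x1 : -1 <= x <= 1 by apply/andP; split; nra.
have xI : x \in `[-1, 1]%R by rewrite in_itv.
have sE : sin (acos x) = `|y|.
  by rewrite sin_acos// (_ : 1 - x ^+ 2 = y ^+ 2) ?sqrtr_sqr//; lra.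
have p0 := pi_gt0 R; have := acos_lepi x1; have := acos_ge0 x1.
have [y0 h0 h1|y0 h0 h1] := leP 0 y.
  exists (acos x); first by rewrite h0/=; lra.
  by rewrite sE ger0_norm// acosK.
(* On the lower half circle the angle is [2 pi - acos x]; it stays below [2 pi] since [y < 0]
   excludes [x = 1]. *)
have a0 : 0 < acos x by apply: acos_gt0; apply/andP; split; nra.
exists (2 * pi - acos x); first by apply/andP; split; lra.
rewrite mulr_natl cosB sinB cos2pi sin2pi sE acosK// ltr0_norm//.
by split; ring.
Qed.

Lemma jordan_circle (b : R) : jordan_curve [set z | sqdist b z = 1].
Proof.
exists (fun t => b%:C + expi t); split.
- apply: continuous_subspaceT => t; apply: complex_cvg_ReIm => /=.
    by apply: cvgD; [exact: cvg_cst|exact: continuous_cos].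
  by apply: cvgD; [exact: cvg_cst|exact: continuous_sin].
- by congr (_ + _); rewrite /expi mulr_natl cos0 sin0 cos2pi sin2pi.
- by move=> s t sI tI /addrI; exact: expi_inj.
- apply/seteqP; split=> z /=.
    rewrite /sqdist => /expi_surj[t tI [ct st]]; exists t => //.
    by apply: complex_ext => /=; rewrite ?ct ?st; lra.
  by move=> [t _ <-]; rewrite /sqdist/= add0r [b + _]addrC addrK cos2Dsin2.
Qed.

Lemma unit_discE : @unit_disc R = [set z | sqdist 0 z < 1].
Proof.
apply/seteqP; split=> z; rewrite /unit_disc /sqdist/= subr0;
  by have := @ltc_normP R z 1 ler01; rewrite expr1n => ->.
Qed.

Lemma exterior_discE : @exterior_disc R = [set z | 1 < sqdist 0 z].
Proof.
apply/seteqP; split=> z; rewrite /exterior_disc /sqdist/= subr0;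
  by have := @gtc_normP R z 1 ler01; rewrite expr1n => ->.
Qed.

Lemma closed_discE r : 0 <= r ->
  [set z : C | `|z| <= r%:C] = [set z | sqdist 0 z <= r ^+ 2].
Proof.
by move=> r0; apply/seteqP; split=> z; rewrite /sqdist/= subr0 lec_normP.
Qed.

Definition affine (u c : R) (z : C) : C := u%:C * z + c%:C.

Lemma sqdist_affine u c c' z :
  sqdist (u * c' + c) (affine u c z) = u ^+ 2 * sqdist c' z.
Proof. by rewrite /sqdist /affine; case: z => x y /=; ring. Qed.

Lemma affineK u c : u != 0 -> cancel (affine u c) (affine u^-1 (- c / u)).
Proof.
move=> u0 [x y]; rewrite /affine; apply: complex_ext => /=; first by field.
by field.
Qed.

Lemma affineVK u c : u != 0 -> cancel (affine u^-1 (- c / u)) (affine u c).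
Proof.
move=> u0 [x y]; rewrite /affine; apply: complex_ext => /=; first by field.
by field.
Qed.

Lemma affine_sqdist_gt u c r : 0 < u ->
  affine u c @` [set z | r < sqdist 0 z] = [set z | u ^+ 2 * r < sqdist c z].
Proof.
move=> u0; have u1 : u != 0 by rewrite gt_eqF.
have h z : (u ^+ 2 * r < sqdist c (affine u c z)) = (r < sqdist 0 z).
  have -> : sqdist c (affine u c z) = u ^+ 2 * sqdist 0 z.
    by rewrite -(sqdist_affine u c) mulr0 add0r.
  by rewrite ltr_pM2l// exprn_gt0.
apply/seteqP; split => [_ [z /= zr <-]|z /= zr]; first by rewrite /= h.
by exists (affine u^-1 (- c / u) z); rewrite ?affineVK//= -h affineVK.
Qed.

Lemma affine_exterior u c : 0 < u ->
  affine u c @` exterior_disc = [set z | u ^+ 2 < sqdist c z].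
Proof. by move=> u0; rewrite exterior_discE affine_sqdist_gt// mulr1. Qed.

Lemma hull_affine u c : 0 < u ->
  hull (affine u c) = [set z | sqdist c z <= u ^+ 2].
Proof.
move=> u0; rewrite /hull affine_exterior//.
by apply/seteqP; split => z /=; rewrite leNgt => /negP.
Qed.

Lemma is_derive_affine u c (z : C) : is_derive z (1 : C) (affine u c) (u%:C : C).
Proof.
pose g : C -> C := (cst u%:C : C -> C) * id + cst c%:C.
have dg : is_derive z (1 : C) g (u%:C : C).
  apply: (is_derive_eq (@is_deriveD R[i] C C _ _ _ _ _ _
    (@is_deriveM R[i] C _ _ _ _ _ _ (is_derive_cst _ _ _) (is_derive_id _ _))
    (is_derive_cst _ _ _))).
  by rewrite addr0 scaler0 addr0; exact: mulr1.
by have -> : affine u c = g by apply/funext.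
Qed.

Lemma exterior_map_affine u c : 0 < u ->
  exterior_map u (hull (affine u c)) (affine u c).
Proof.
move=> u0; split => //.
- split; first by move=> z _; have [] := is_derive_affine u c z.
  rewrite /hull setCK; split; first by move=> z Dz; exists z.
    by move=> z w _ _; apply: (can_inj (@affineK u c _)); rewrite gt_eqF.
  by [].
- exists `|c|, 0 => z _; rewrite /affine addrC addKr.
  by rewrite lec_normP//= expr0n addr0 real_normK ?num_real.
Qed.

(** With [k = 1 - b ^+ 2] and [0 < b < 1] this is the Riemann map of the unit disc onto the unit
    disc around [b] that fixes 0 with positive derivative. *)
Definition moebius (k b : R) (z : C) : C := k%:C * z / (1 - b%:C * z).

Lemma is_derive_moebius k b (z : C) : 1 - b%:C * z != 0 ->
  is_derive z (1 : C) (moebius k b) (k%:C / (1 - b%:C * z) ^+ 2 : C).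
Proof.
move=> z0; pose d : C -> C := (cst 1 : C -> C) - (cst b%:C : C -> C) * id.
have d1 : is_derive z (1 : C) d (- b%:C : C).
  apply: (is_derive_eq (@is_deriveB R[i] C C _ _ _ _ _ _ (is_derive_cst _ _ _)
    (@is_deriveM R[i] C _ _ _ _ _ _ (is_derive_cst _ _ _) (is_derive_id _ _)))).
  by rewrite sub0r scaler0 addr0; congr (- _); exact: mulr1.
have dV : is_derive z (1 : C) (fun x => (d x)^-1 : C) (- (d z) ^- 2 *: - b%:C : C).
  have [dd dE] := d1.
  apply: (@DeriveDef R[i] C C).
    by apply: derivableV.
  by rewrite deriveV// dE.
pose g : C -> C := ((cst k%:C : C -> C) * id : C -> C) * (fun x => (d x)^-1 : C).
have -> : moebius k b = g by apply/funext.
rewrite /g; apply: (@is_derive_eq R[i] C C).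
rewrite scaler0 addr0 scalerN scaleNr opprK.
rewrite (_ : d z = 1 - b%:C * z)//.
change (k%:C * z * ((1 - b%:C * z) ^- 2 * b%:C) + (1 - b%:C * z)^-1 * (k%:C * 1) =
  k%:C / (1 - b%:C * z) ^+ 2 :> R[i]).
by field.
Qed.

Lemma moebius_den_neq0 (b : R) (z : C) : 0 <= b < 1 -> sqdist 0 z <= 1 -> 1 - b%:C * z != 0.
Proof.
move=> /andP[b0 b1]; rewrite /sqdist subr0 => z1; apply/eqP => h.
have /= : Re (1 - b%:C * z) = 0 by rewrite h.
by case: z z1 {h} => x y/=; nra.
Qed.

(** Explicit form of the fact that the image of [|z| = r] is the circle of radius [u] around
    [b r u], both read off from the images of the real points [r] and [-r]. The factor on the right
    is positive for [k != 0] and [b ^+ 2 * r ^+ 2 < 1], since [sqdist 1 (b z)] is the squared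
    modulus of the denominator. *)
Lemma sqdist_moebius (k b r : R) (z : C) : 1 - b ^+ 2 * r ^+ 2 != 0 ->
    1 - b%:C * z != 0 ->
  let u := k * r / (1 - b ^+ 2 * r ^+ 2) in
  sqdist (b * r * u) (moebius k b z) - u ^+ 2 =
  (k / (1 - b ^+ 2 * r ^+ 2)) ^+ 2 * (1 - b ^+ 2 * r ^+ 2) /
  sqdist 1 (b%:C * z) * (sqdist 0 z - r ^+ 2).
Proof.
move=> br; rewrite /moebius /sqdist; case: z => x y /=.
rewrite eq_complex/= negb_and => d0.
have D0 : (1 - (b * x - 0 * y)) ^+ 2 + (- (b * y + 0 * x)) ^+ 2 != 0.
  rewrite paddr_eq0 ?sqr_ge0// !sqrf_eq0.
  by apply/negP => /andP[/eqP h1 /eqP h2]; move: d0; rewrite add0r h1 h2 !eqxx.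
rewrite ?mul0r ?subr0 ?addr0 ?sub0r ?sqrrN in D0 *.
by field; rewrite -(opprB 1) sqrrN D0 exprMn br.
Qed.

Section Moebius.
Variables b r : R.
Hypotheses (b01 : 0 < b < 1) (r01 : 0 < r <= 1).
Let k := 1 - b ^+ 2.
Let u := k * r / (1 - b ^+ 2 * r ^+ 2).

Let k0 : 0 < k.
Proof. by case/andP: b01 => b0 b1; rewrite subr_gt0 expr_lt1// ltW. Qed.

Let br0 : 0 < 1 - b ^+ 2 * r ^+ 2.
Proof.
case/andP: b01 => b0 b1; case/andP: r01 => r0 r1.
by rewrite -exprMn subr_gt0 expr_lt1//; nra.
Qed.

Let u0 : 0 < u.
Proof. by case/andP: r01 => r0 r1; rewrite divr_gt0// mulr_gt0. Qed.

Let sqdist_moebiusE (z : C) : 1 - b%:C * z != 0 ->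
  exists2 q, 0 < q &
  sqdist (b * r * u) (moebius k b z) - u ^+ 2 = q * (sqdist 0 z - r ^+ 2).
Proof.
move=> z0; exists ((k / (1 - b ^+ 2 * r ^+ 2)) ^+ 2 * (1 - b ^+ 2 * r ^+ 2) /
  sqdist 1 (b%:C * z)); last by rewrite sqdist_moebius// gt_eqF.
rewrite divr_gt0//; first by rewrite mulr_gt0// exprn_gt0// divr_gt0.
rewrite lt_neqAle addr_ge0 ?sqr_ge0// andbT eq_sym.
rewrite paddr_eq0 ?sqr_ge0// !sqrf_eq0; apply: contraNN z0 => /andP[/eqP h1 /eqP h2].
apply/eqP/complex_ext; first by rewrite cReB /= -/(Re _); lra.
by rewrite cImB h2 subr0.
Qed.

Lemma moebius_sqdist_le (z : C) : sqdist 0 z <= 1 ->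
  (sqdist (b * r * u) (moebius k b z) <= u ^+ 2) = (sqdist 0 z <= r ^+ 2).
Proof.
move=> z1; have [|q q0] := @sqdist_moebiusE z.
  by apply: moebius_den_neq0 => //; case/andP: b01 => /ltW -> ->.
by rewrite -subr_le0 => ->; rewrite pmulr_rle0// subr_le0.
Qed.

Lemma moebius_sqdist_lt (z : C) : sqdist 0 z <= 1 ->
  (sqdist (b * r * u) (moebius k b z) < u ^+ 2) = (sqdist 0 z < r ^+ 2).
Proof.
move=> z1; have [|q q0] := @sqdist_moebiusE z.
  by apply: moebius_den_neq0 => //; case/andP: b01 => /ltW -> ->.
by rewrite -subr_lt0 => ->; rewrite pmulr_rlt0// subr_lt0.
Qed.

Lemma moebius_surj (w : C) : sqdist (b * r * u) w <= u ^+ 2 ->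
  exists2 z, sqdist 0 z <= r ^+ 2 & moebius k b z = w.
Proof.
case/andP: (b01) => b0 b1; case/andP: (r01) => r0 r1 wu.
(* The only obstruction is the pole [- k / b] of the inverse map; its distance to the center is
   [u / (b r)], more than [u]. *)
have w0 : k%:C + b%:C * w != 0.
  apply/eqP => h; have := congr1 (@complex.Re R) h; have := congr1 (@complex.Im R) h.
  rewrite /= !cReD !cImD !cReM !cImM /= => hi hr.
  have : b ^+ 2 * sqdist (b * r * u) w = (u / r) ^+ 2.
    rewrite /sqdist mulrDr -!exprMn mulrBr.
    have -> : b * Re w = - k by lra.
    have -> : b * Im w = 0 by lra.
    rewrite expr0n addr0 /u; field.
    by rewrite exprMn !gt_eqF.
  have ru : u ^+ 2 <= (u / r) ^+ 2.
    have ur : u <= u / r by rewrite ler_pdivlMr// ger_pMr.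
    by rewrite lerXn2r// nnegrE ltW// divr_gt0.
  have : b ^+ 2 * sqdist (b * r * u) w <= b ^+ 2 * u ^+ 2.
    by rewrite ler_pM2l// exprn_gt0.
  have : b ^+ 2 * u ^+ 2 < u ^+ 2 by rewrite gtr_pMl ?exprn_gt0// expr_lt1// ltW.
  by lra.
have kC : k%:C != 0 :> C by rewrite eq_complex/= gt_eqF.
(* Solution of [w = k z / (1 - b z)]. *)
pose z : C := w / (k%:C + b%:C * w).
have zE : 1 - b%:C * z = k%:C / (k%:C + b%:C * w) :> R[i].
  by rewrite /z; field.
have z0 : 1 - b%:C * z != 0 by rewrite zE mulf_neq0// invr_neq0.
have fz : moebius k b z = w.
  by rewrite /moebius zE /z; field; rewrite w0.
exists z => //; have [q q0] := sqdist_moebiusE z0.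
rewrite fz => h; rewrite -subr_le0 -(pmulr_rle0 _ q0) -h subr_le0//.
Qed.

Lemma moebius_closed_disc :
  moebius k b @` [set z : C | `|z| <= r%:C] =
  [set w | sqdist (b * r * u) w <= u ^+ 2].
Proof.
case/andP: r01 => r0 r1.
have r2 : r ^+ 2 <= 1 by rewrite exprn_ile1// ltW.
rewrite closed_discE ?ltW//; apply/seteqP; split => [_ [z /= zr <-]|w /moebius_surj[z zr <-]].
  by rewrite /= moebius_sqdist_le// (le_trans zr).
by exists z.
Qed.

End Moebius.

Lemma moebius_conformal b : 0 < b < 1 ->
  conformal unit_disc [set w : C | sqdist b w < 1] (moebius (1 - b ^+ 2) b).
Proof.
move=> b01; case/andP: (b01) => b0 b1.
have r01 : 0 < (1 : R) <= 1 by rewrite ltr01 lexx.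
have k0 : 1 - b ^+ 2 != 0 by rewrite gt_eqF// subr_gt0 expr_lt1// ltW.
(* At [r = 1] the image circle has radius 1 and center [b], which explains the value of [k]. *)
have uE : (1 - b ^+ 2) * 1 / (1 - b ^+ 2 * 1 ^+ 2) = 1 :> R.
  by rewrite expr1n !mulr1 divff.
have den (z : C) : sqdist 0 z <= 1 -> 1 - b%:C * z != 0.
  by apply: moebius_den_neq0; rewrite (ltW b0).
have lt := moebius_sqdist_lt b01 r01; rewrite uE !mulr1 expr1n in lt.
rewrite unit_discE; split.
  by move=> z /= /ltW z1; have [] := is_derive_moebius (1 - b ^+ 2) (den _ z1).
split.
- by move=> z /= z1; rewrite lt// ltW.
- move=> z w; rewrite !inE/= => /ltW/den z1 /ltW/den w1; rewrite /moebius => h.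
  have kC : (1 - b ^+ 2)%:C != 0 :> C by rewrite eq_complex/= negb_and k0.
  have : (1 - b ^+ 2)%:C * z * (1 - b%:C * w) = (1 - b ^+ 2)%:C * w * (1 - b%:C * z) :> R[i].
    by apply/eqP; rewrite -eqr_div//; apply/eqP.
  rewrite -!mulrA => /(mulfI kC) e.
  have -> : z = z * (1 - b%:C * w) + b%:C * z * w by ring.
  by rewrite e; ring.
- move=> w /= w1; have := moebius_surj b01 r01; rewrite uE !mulr1 expr1n.
  move=> /(_ w (ltW w1))[z z1 zw]; exists z => //=.
  by rewrite -lt// zw.
Qed.

End Circles.

(** * Fundamental theorem of calculus on bounded real intervals *)

Section RealIntegrals.
Context {R : realType}.
Local Notation leb := (@lebesgue_measure R).

Lemma continuous_integrable_itvcc (f : R -> R) (a b : R) : continuous f ->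
  leb.-integrable `[a, b] (EFin \o f).
Proof.
move=> cf; apply: continuous_compact_integrable; first exact: segment_compact.
exact: continuous_subspaceT.
Qed.

Lemma continuous_integrable_itvco (f : R -> R) (a b : R) : continuous f ->
  leb.-integrable `[a, b[ (EFin \o f).
Proof.
move=> cf; apply: integrableS (continuous_integrable_itvcc a b cf) => //.
by apply: subset_itvl; rewrite bnd_simp.
Qed.

(** The degenerate case [a = b] is included because the chain equation is stated for all
    [s <= t]. *)
Lemma ftc_itvcc (F f : R -> R) (a b : R) : a <= b ->
  (forall x : R, is_derive x (1 : R) F (f x)) -> continuous f ->
  (\int[leb]_(x in `[a, b]) (f x)%:E)%E = (F b - F a)%:E.
Proof.
rewrite le_eqVlt => /predU1P[<- _ _|ab dF cf].
  by rewrite set_itv1 integral_set1 subrr.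
rewrite (@continuous_FTC2 R f F)//.
- exact: continuous_subspaceT.
- have cF : continuous F.
    by move=> x; apply/differentiable_continuous/derivable1_diffP; have [] := dF x.
  split; first by move=> x _; have [] := dF x.
    by apply: cvg_at_right_filter; exact: cF.
  by apply: cvg_at_left_filter; exact: cF.
- by move=> x _; rewrite derive1E; have [_ ->] := dF x.
Qed.

Lemma ftc_itvco (F f : R -> R) (a b : R) : a <= b ->
  (forall x : R, is_derive x (1 : R) F (f x)) -> continuous f ->
  (\int[leb]_(x in `[a, b[) (f x)%:E)%E = (F b - F a)%:E.
Proof.
move=> ab dF cf; rewrite integral_itv_bndo_bndc; first exact: ftc_itvcc.
apply/measurable_EFinP/measurable_funTS.
exact: continuous_measurable_fun.
Qed.

End RealIntegrals.

(** * Integrals over the unit circle *)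

Section CircleIntegrals.
Context {R : realType}.
Local Notation C := (Cplx R).
Local Notation Re := complex.Re.
Local Notation Im := complex.Im.
Local Notation leb := (@lebesgue_measure R).
Local Notation circ := (@circle R).
Local Notation cint := (cintegral leb circ).

Lemma measurable_circle : measurable circ.
Proof. exact: measurable_itv. Qed.

Let mcirc := measurable_circle.

Lemma continuous_Re_comp (f : R -> C) : continuous f -> continuous (fun x => Re (f x)).
Proof. by move=> cf x; apply: continuous_comp (cf x) _; exact: Re_continuous. Qed.

Lemma continuous_Im_comp (f : R -> C) : continuous f -> continuous (fun x => Im (f x)).
Proof. by move=> cf x; apply: continuous_comp (cf x) _; exact: Im_continuous. Qed.

Lemma continuous_integrable_circle (f : R -> R) : continuous f ->
  leb.-integrable circ (EFin \o f).
Proof. exact: continuous_integrable_itvco. Qed.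

Let intc := continuous_integrable_circle.
Let cRe := continuous_Re_comp.
Let cIm := continuous_Im_comp.

Lemma cintD (f g : R -> C) : continuous f -> continuous g ->
  cint (fun x => f x + g x) = cint f + cint g.
Proof.
move=> cf cg; apply: complex_ext; rewrite ?cReD ?cImD /=.
  under eq_Rintegral do rewrite cReD.
  by rewrite RintegralD//; apply: intc; exact: cRe.
under eq_Rintegral do rewrite cImD.
by rewrite RintegralD//; apply: intc; exact: cIm.
Qed.

Lemma cintZ (c : C) (f : R -> C) : continuous f ->
  cint (fun x => c * f x) = c * cint f.
Proof.
move=> cf; have iR := intc (cRe cf); have iI := intc (cIm cf).
have iZ a g : leb.-integrable circ (EFin \o g) ->
    leb.-integrable circ (EFin \o (fun x : R => a * g x : R)).
  by move=> ig; apply: (integrableZl mcirc a ig).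
apply: complex_ext; rewrite ?cReM ?cImM /=.
  under eq_Rintegral do rewrite cReM.
  by rewrite RintegralB ?RintegralZl//; exact: iZ.
under eq_Rintegral do rewrite cImM.
by rewrite RintegralD ?RintegralZl//; exact: iZ.
Qed.

Lemma continuous_expi : continuous (@expi R).
Proof.
by move=> t; apply: complex_cvg_ReIm; [exact: continuous_cos|exact: continuous_sin].
Qed.

Lemma expiX (x : R) n : expi x ^+ n = expi (n%:R * x) :> R[i].
Proof.
elim: n => [|n ih]; first by rewrite mul0r /expi cos0 sin0.
rewrite exprS ih -natr1 mulrDl mul1r /expi cosD sinD.
by apply: complex_ext => /=; ring.
Qed.

Lemma continuous_expiX n : continuous (fun x => expi x ^+ n : C).
Proof.
move=> x; rewrite (_ : (fun x => _) = (fun x => expi (n%:R * x))); last first.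
  by apply/funext => y; rewrite expiX.
by apply: continuous_comp; [exact: mulrl_continuous|exact: continuous_expi].
Qed.

(** For [n > 0] the real and imaginary parts have the primitives [sin (n x) / n] and
    [- cos (n x) / n], which are periodic. *)
Lemma cint_expiX n : (0 < n)%N -> cint (fun x => expi x ^+ n) = 0.
Proof.
move=> n0; have nR : n%:R != 0 :> R by rewrite pnatr_eq0 -lt0n.
have p2 : 0 <= 2 * pi :> R by rewrite mulr_ge0// pi_ge0.
have per : n%:R * (2 * pi) = 0 + (pi *+ 2) *+ n :> R.
  by rewrite add0r !mulr_natl.
rewrite (_ : (fun x => _) = (fun x => expi (n%:R * x))); last first.
  by apply/funext => y; rewrite expiX.
have nx : continuous (fun x : R => n%:R * x) by exact: mulrl_continuous.
have dS x : is_derive (x : R) (1 : R) (fun x => sin (n%:R * x) / n%:R) (cos (n%:R * x)).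
  by apply: is_derive_eq; rewrite /GRing.scale/=; field.
have dC x : is_derive (x : R) (1 : R) (fun x => - cos (n%:R * x) / n%:R) (sin (n%:R * x)).
  by apply: is_derive_eq; rewrite /GRing.scale/=; field.
apply: complex_ext => /=; rewrite /Rintegral.
  rewrite (ftc_itvco p2 dS); first by rewrite per (periodicn (@sinD2pi R)) mulr0 subrr.
  by move=> x; apply: continuous_comp; [exact: nx|exact: continuous_cos].
rewrite (ftc_itvco p2 dC); first by rewrite per (periodicn (@cosD2pi R)) mulr0 subrr.
by move=> x; apply: continuous_comp; [exact: nx|exact: continuous_sin].
Qed.

Lemma sqdist0M (z w : C) : sqdist 0 (z * w) = sqdist 0 z * sqdist 0 w.
Proof. by rewrite /sqdist cReM cImM; ring. Qed.

Lemma sqdist0X (z : C) n : sqdist 0 (z ^+ n) = sqdist 0 z ^+ n.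
Proof.
elim: n => [|n ih]; first by rewrite /sqdist/= subr0 expr1n expr0n addr0.
by rewrite !exprS sqdist0M ih.
Qed.

Lemma sqdist0_expi x : sqdist 0 (@expi R x) = 1.
Proof. by rewrite /sqdist/= subr0 cos2Dsin2. Qed.

Section PoissonKernel.
Variable w : C.
Hypothesis w1 : sqdist 0 w < 1.

Let g (x : R) : C := (1 - w * expi x)^-1.

Lemma one_minus_expi_neq0 x : 1 - w * expi x != 0.
Proof.
apply/eqP => /eqP; rewrite subr_eq0 => /eqP h.
have := sqdist0M w (expi x); rewrite sqdist0_expi -h /sqdist/= => e.
by move: w1; rewrite /sqdist; lra.
Qed.

Let cg : continuous g.
Proof.
move=> x; apply: (@cvgV R[i] _ (nbhs x)); first exact: one_minus_expi_neq0.
apply: (@cvgB _ _ _ (nbhs x)); first exact: cvg_cst.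
by apply: (@cvgM R[i] _ (nbhs x)); [exact: cvg_cst|exact: continuous_expi].
Qed.

Let cXg n : continuous (fun x => expi x ^+ n * g x : C).
Proof.
by move=> x; apply: (@cvgM R[i] _ (nbhs x)); [exact: continuous_expiX|exact: cg].
Qed.

(** Expanding [g] as a geometric series suggests that only [M 0] is nonzero; the recursion below
    proves it without exchanging sum and integral. *)
Let M n : C := cint (fun x => expi x ^+ n * g x).

Let M_rec n : M n = cint (fun x => expi x ^+ n) + w * M n.+1.
Proof.
have cw : continuous (fun x => w * (expi x ^+ n.+1 * g x) : C).
  by move=> x; apply: (@cvgM R[i] _ (nbhs x)); [exact: cvg_cst|exact: cXg].
rewrite /M -(cintZ w (@cXg n.+1)) -(cintD (@continuous_expiX n) cw).
congr cintegral; apply/funext => x.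
have := one_minus_expi_neq0 x; rewrite /g exprS => h.
change (expi x ^+ n / (1 - w * expi x) = expi x ^+ n +
  w * (expi x * expi x ^+ n / (1 - w * expi x)) :> R[i]).
by field.
Qed.

Let M_iter n k : (0 < n)%N -> M n = w ^+ k * M (n + k)%N.
Proof.
move=> n0; elim: k => [|k ->]; first by rewrite mul1r addn0.
by rewrite M_rec cint_expiX ?addn_gt0 ?n0// add0r mulrA -exprSr addnS.
Qed.

Let B := \int[leb]_(x in circ) (`|Re (g x)| + `|Im (g x)|).

(** What counts is uniformity in [n]: the unimodular factor [expi x ^+ n] only rotates [g x], so
    each coordinate stays below [|Re g| + |Im g|]. *)
Let M_bound n : sqdist 0 (M n) <= 2 * B ^+ 2.
Proof.
have cb : continuous (fun x => `|Re (g x)| + `|Im (g x)|).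
  by move=> x; apply: cvgD; apply: cvg_norm; [exact: (cRe cg)|exact: (cIm cg)].
have bound (f : R -> R) : continuous f ->
    (forall x, `|f x| <= `|Re (g x)| + `|Im (g x)|) ->
    `|\int[leb]_(x in circ) f x| <= B.
  move=> cf fb; apply: (le_trans (le_normr_Rintegral mcirc (intc cf))).
  apply: le_Rintegral => //; apply: intc => //.
  by move=> x; apply: cvg_norm; exact: cf.
have hb (a b p q : R) : a ^+ 2 + b ^+ 2 = 1 -> `|a * p + b * q| <= `|p| + `|q|.
  move=> ab; have a1 : `|a| <= 1 by rewrite ler_norml; apply/andP; split; nra.
  have b1 : `|b| <= 1 by rewrite ler_norml; apply/andP; split; nra.
  by rewrite (le_trans (ler_normD _ _))// !normrM lerD// ler_piMl.
have hR : `|Re (M n)| <= B.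
  apply: bound; first exact: (cRe (@cXg n)).
  move=> x; rewrite cReM expiX /= -mulNr; apply: hb.
  by rewrite sqrrN cos2Dsin2.
have hI : `|Im (M n)| <= B.
  apply: bound; first exact: (cIm (@cXg n)).
  by move=> x; rewrite cImM expiX /= addrC; apply: hb; rewrite addrC cos2Dsin2.
have sq (a : R) : `|a| <= B -> a ^+ 2 <= B ^+ 2.
  move=> aB; rewrite -(real_normK (num_real a)) lerXn2r ?nnegrE//.
  exact: le_trans (normr_ge0 a) aB.
by rewrite /sqdist subr0; have := sq _ hR; have := sq _ hI; lra.
Qed.

(* The moments are bounded, and M n = w^k M (n + k) for every k. *)
Let M_eq0 n : (0 < n)%N -> M n = 0.
Proof.
move=> n0; have q0 : 0 <= sqdist 0 w by rewrite addr_ge0// sqr_ge0.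
suff : sqdist 0 (M n) <= 0.
  rewrite /sqdist subr0; have := sqr_ge0 (Re (M n)); have := sqr_ge0 (Im (M n)).
  move=> hi hr h; apply: complex_ext; apply/eqP; rewrite -sqrf_eq0 eq_le ?hi ?hr andbT; lra.
have h k : sqdist 0 (M n) <= 2 * B ^+ 2 * sqdist 0 w ^+ k.
  by rewrite (M_iter k n0) sqdist0M sqdist0X mulrC ler_wpM2r// exprn_ge0.
have cv : 2 * B ^+ 2 * sqdist 0 w ^+ k @[k --> \oo] --> 2 * B ^+ 2 * 0.
  by apply: cvgMl_tmp; apply: cvg_expr; rewrite ger0_norm.
rewrite mulr0 in cv.
by apply: (cvgr_to_ge cv); near=> k; exact: h.
Unshelve. all: by end_near. Qed.

Let cint1 (a : R) : cint (fun x => (1 + a * cos x)%:C) = (2 * pi)%:C.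
Proof.
have p2 : 0 <= 2 * pi :> R by rewrite mulr_ge0// pi_ge0.
have dF x : is_derive (x : R) (1 : R) (fun x => x + a * sin x) (1 + a * cos x).
  by apply: is_derive_eq.
have cF : continuous (fun x => 1 + a * cos x).
  move=> x; apply: cvgD; first exact: cvg_cst.
  by apply: cvgMl_tmp; exact: continuous_cos.
apply: complex_ext => /=; last by rewrite Rintegral_cst// mul0r.
by rewrite /Rintegral (ftc_itvco p2 dF cF) /= mulr_natl sin2pi sin0; ring.
Qed.

(** With [w = 1 / z] this is, up to [2 pi], the Herglotz transform of the density [1 + a cos]; with
    [a = 0] and real [w] its real part is the integral of the Poisson kernel. *)
Lemma herglotz_mean (a : R) :
  cint (fun x => (1 + w * expi x) / (1 - w * expi x) * (1 + a * cos x)%:C) =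
  (2 * pi)%:C * (1 + a%:C * w).
Proof.
have c1 : continuous (fun x => (1 + a * cos x)%:C : C).
  move=> x; apply: complex_cvg_ReIm => /=; last exact: cvg_cst.
  apply: cvgD; first exact: cvg_cst.
  by apply: cvgMl_tmp; exact: continuous_cos.
have cw (v : C) n : continuous (fun x => v * (expi x ^+ n * g x) : C).
  by move=> x; apply: (@cvgM R[i] _ (nbhs x)); [exact: cvg_cst|exact: cXg].
have cD (f h : R -> C) : continuous f -> continuous h -> continuous (fun x => f x + h x : C).
  by move=> cf ch x; apply: (@cvgD _ _ _ (nbhs x)); [exact: cf|exact: ch].
pose v := a%:C * w.
(* Splitting into moments: [2 cos x e^{ix} = e^{2ix} + 1] absorbs the cosine, so no negative powers
   occur. *)
transitivity (cint (fun x => (1 + a * cos x)%:C + 2 * w * (expi x ^+ 1 * g x)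
    + v * (expi x ^+ 2 * g x) + v * (expi x ^+ 0 * g x))).
  congr cintegral; apply/funext => x.
  have cE : expi x ^+ 2 = 2 * (cos x)%:C * expi x - 1 :> R[i].
    have h := cos2Dsin2 x; rewrite /expi; apply: complex_ext => /=; last by ring.
    lra.
  have := one_minus_expi_neq0 x; rewrite /v /g cE expr0 expr1.
  have -> : (1 + a * cos x)%:C = 1 + a%:C * (cos x)%:C :> R[i].
    by apply: complex_ext => /=; ring.
  move: (expi x) (cos x)%:C => e c D0.
  change ((1 + w * e) / (1 - w * e) * (1 + a%:C * c) =
    1 + a%:C * c + 2 * w * (e * (1 - w * e)^-1) +
    a%:C * w * ((2 * c * e - 1) * (1 - w * e)^-1) +
    a%:C * w * (1 * (1 - w * e)^-1) :> R[i]).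
  by field.
rewrite (cintD (cD _ _ (cD _ _ c1 (@cw _ 1)) (@cw _ 2)) (@cw _ 0)).
rewrite (cintD (cD _ _ c1 (@cw _ 1)) (@cw _ 2)) (cintD c1 (@cw _ 1)) cint1.
rewrite (cintZ _ (@cXg 1)) (cintZ _ (@cXg 2)) (cintZ _ (@cXg 0)).
rewrite -/(M 0) -/(M 1) -/(M 2) (@M_eq0 1)// (@M_eq0 2)// !mulr0 !addr0.
rewrite M_rec (@M_eq0 1)// mulr0 addr0.
have -> : cint (fun x => expi x ^+ 0) = (2 * pi)%:C.
  rewrite -(cint1 0); congr cintegral; apply/funext => x.
  by rewrite expr0 mul0r addr0.
have alg (p q : R[i]) : p + q * p = p * (1 + q) by ring.
exact: alg.
Qed.

End PoissonKernel.

End CircleIntegrals.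

(** * Circle integrals of the reciprocal and the logarithm of [1 + a cos] *)

Section LogMean.
Context {R : realType}.
Local Notation leb := (@lebesgue_measure R).
Local Notation circ := (@circle R).

Let mcirc := @measurable_circle R.

Lemma cos_pos_gt0 (a x : R) : 0 <= a < 1 -> 0 < 1 + a * cos x.
Proof. by case/andP => a0 a1; have := cos_geN1 x; have := cos_le1 x; nra. Qed.

Lemma continuous_1Dacos (a : R) : continuous (fun x => 1 + a * cos x).
Proof.
move=> x; apply: cvgD; first exact: cvg_cst.
by apply: cvgMl_tmp; exact: continuous_cos.
Qed.

Lemma continuous_ln1Dacos (a : R) : 0 <= a < 1 ->
  continuous (fun x => ln (1 + a * cos x)).
Proof.
move=> a1 x; apply: continuous_comp; first exact: continuous_1Dacos.
by apply: continuous_ln; exact: cos_pos_gt0.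
Qed.

Lemma continuous_inv1Dacos (a : R) : 0 <= a < 1 ->
  continuous (fun x => (1 + a * cos x)^-1).
Proof.
move=> a1 x; apply: cvgV; first by rewrite gt_eqF// cos_pos_gt0.
exact: continuous_1Dacos.
Qed.

Variable b : R.
Hypothesis b01 : 0 < b < 1.
Let a := 2 * b / (1 + b ^+ 2).

Let a01 : 0 <= a < 1.
Proof.
case/andP: b01 => b0 b1; have b2 : 0 < 1 + b ^+ 2 by rewrite ltr_pwDl// sqr_ge0.
rewrite /a divr_ge0 ?(ltW b2) ?mulr_ge0 ?(ltW b0)//=.
by rewrite ltr_pdivrMr// mul1r; nra.
Qed.

(* The reciprocal of 1 + a cos is a multiple of the Poisson kernel at -b. *)
Let integral_inv1Dacos :
  \int[leb]_(x in circ) (1 + a * cos x)^-1 = 2 * pi * (1 + b ^+ 2) / (1 - b ^+ 2).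
Proof.
case/andP: b01 => b0 b1.
have b2 : 1 - b ^+ 2 != 0 by rewrite gt_eqF// subr_gt0 expr_lt1// ltW.
have b2' : 1 + b ^+ 2 != 0 by rewrite gt_eqF// ltr_pwDl// sqr_ge0.
have w1 : sqdist 0 ((- b)%:C : Cplx R) < 1.
  by rewrite /sqdist/= subr0 expr0n addr0 sqrrN expr_lt1// ltW.
have := congr1 (@complex.Re R) (herglotz_mean w1 0).
rewrite /= ?mul0r ?mulr0 ?subr0 ?addr0 ?mulr1.
move=> h.
have : \int[leb]_(x in circ) ((1 - b ^+ 2) / (1 + b ^+ 2) * (1 + a * cos x)^-1) = 2 * pi.
  rewrite -h; apply: eq_Rintegral => x _; apply/esym.
  have h0 := cos_pos_gt0 x a01; have h1 := cos2Dsin2 x.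
  have c0 : 1 + b ^+ 2 + 2 * b * cos x != 0.
    apply: contraTneq h0 => c0; rewrite /a (_ : _ + _ = 0) ?ltxx//.
    have -> : 1 + 2 * b / (1 + b ^+ 2) * cos x = (1 + b ^+ 2 + 2 * b * cos x) / (1 + b ^+ 2).
      by field.
    by rewrite c0 mul0r.
  have aE : 1 + a * cos x = (1 + b ^+ 2 + 2 * b * cos x) / (1 + b ^+ 2).
    by rewrite /a; field.
  have NE : (1 - (- b * cos x - 0 * sin x)) ^+ 2 + (0 - (- b * sin x + 0 * cos x)) ^+ 2 =
      1 + b ^+ 2 + 2 * b * cos x.
    rewrite [LHS](_ : _ = 1 + 2 * b * cos x + b ^+ 2 * (cos x ^+ 2 + sin x ^+ 2)); last by ring.
    by rewrite h1; ring.
  rewrite aE /= NE; move: (1 + b ^+ 2 + _) c0 => N N0.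
  transitivity ((1 - b ^+ 2 * (cos x ^+ 2 + sin x ^+ 2)) / N).
    by field; rewrite N0.
  by rewrite h1 mulr1; field; rewrite b2' N0.
rewrite RintegralZl//; last first.
  by apply: continuous_integrable_circle; exact: continuous_inv1Dacos.
by move=> <-; field; rewrite b2 b2'.
Qed.

(** Up to [2 pi] this is the derivative in [a] of the entropy of [1 + a cos]; the substitution for
    [a] makes it the parameter [b] itself. *)
Lemma integral_cosln :
  (\int[leb]_(x in circ) (cos x * ln (1 + a * cos x))%:E)%E = (2 * pi * b)%:E.
Proof.
case/andP: (b01) => b0 b1.
have a0 : a != 0.
  by rewrite gt_eqF// divr_gt0 ?mulr_gt0// ltr_pwDl// sqr_ge0.
have p2 : 0 <= 2 * pi :> R by rewrite mulr_ge0// pi_ge0.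
(* Integration by parts leaves [a sin^2 / (1 + a cos)]; division by [1 + a cos] turns it into
   [1 / a - cos] plus the remainder [G]. *)
pose G x := (a - a^-1) * (1 + a * cos x)^-1.
pose H x := cos x * ln (1 + a * cos x) - G x.
have cG : continuous G.
  by move=> x; apply: cvgMl_tmp; exact: continuous_inv1Dacos.
have cH : continuous H.
  move=> x; apply: cvgB; last exact: cG.
  by apply: cvgM; [exact: continuous_cos|exact: continuous_ln1Dacos].
have dF (x : R) : is_derive x (1 : R)
    (fun x => sin x * ln (1 + a * cos x) - sin x + x / a) (H x).
  have h0 := cos_pos_gt0 x a01.
  have dl : is_derive x (1 : R) (fun x => ln (1 + a * cos x))
      ((1 + a * cos x)^-1 * (- (a * sin x))).
    have dg : is_derive x (1 : R) (fun x => 1 + a * cos x) (- (a * sin x)).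
      apply: is_derive_eq.
      by rewrite add0r mul1r scalerN.
    exact: (@is_derive1_comp R (@ln R) (fun x => 1 + a * cos x) x _ _ (is_derive1_ln h0) dg).
  apply: is_derive_eq; rewrite /H /G /GRing.scale/=.
  have -> : sin x * ((1 + a * cos x)^-1 * - (a * sin x)) =
      - a * (1 - cos x ^+ 2) / (1 + a * cos x).
    by rewrite -sin2cos2; field; rewrite gt_eqF.
  by field; rewrite a0 gt_eqF.
have HE := ftc_itvco p2 dF cH.
transitivity (\int[leb]_(x in circ) ((H x)%:E + (G x)%:E))%E.
  by apply: eq_integral => x _; rewrite -EFinD /H subrK.
rewrite integralD//=; try exact: continuous_integrable_circle.
  rewrite [X in (X + _)%E]HE.
  have cI := continuous_inv1Dacos a01.
  have -> : (\int[leb]_(x in circ) (G x)%:E)%E =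
      ((a - a^-1) * (2 * pi * (1 + b ^+ 2) / (1 - b ^+ 2)))%:E.
    rewrite -integral_inv1Dacos -RintegralZl//; last exact: continuous_integrable_circle.
    by rewrite fineK//; apply: integrable_fin_num => //; exact: (continuous_integrable_circle cG).
  rewrite -EFinD mulr_natl sin2pi sin0; congr EFin.
  rewrite !mul0r /a -mulr_natl; field.
  have b2 : 1 - b ^+ 2 != 0 by rewrite gt_eqF// subr_gt0 expr_lt1// ltW.
  have b2' : 1 + b ^+ 2 != 0 by rewrite gt_eqF// ltr_pwDl// sqr_ge0.
  by rewrite b2 b2' gt_eqF.
Qed.

End LogMean.

(** * Measures with a density *)

Section DensityMeasure.
Local Open Scope ereal_scope.
Context d (T : measurableType d) (R : realType).
Variable mu : {measure set T -> \bar R}.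
Variable f : T -> R.
Hypothesis mf : measurable_fun setT f.
Hypothesis f0 : forall x, (0 <= f x)%R.

(** The proofs are arguments so that the measure structure can be attached to the function
    itself. *)
Definition density_measure of measurable_fun setT f & (forall x, (0 <= f x)%R) :=
  fun A : set T => \int[mu]_(x in A) (f x)%:E.

Local Notation nu := (density_measure mf f0).

Let nu0 : nu set0 = 0.
Proof. by rewrite /density_measure integral_set0. Qed.

Let nu_ge0 A : 0 <= nu A.
Proof. by apply: integral_ge0 => x _; rewrite lee_fin. Qed.

Let nu_sigma_additive : semi_sigma_additive nu.
Proof.
apply: (@semi_sigma_additive_nng_induced _ _ _ mu (EFin \o f)).
  exact/measurable_EFinP.
by move=> x; rewrite lee_fin.
Qed.

HB.instance Definition _ := isMeasure.Build _ _ _ nu nu0 nu_ge0 nu_sigma_additive.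

Import HBNNSimple.

Let integral_density_nnsfun (h : {nnsfun T >-> R}) :
  \int[nu]_x (h x)%:E = \int[mu]_x ((h x)%:E * (f x)%:E).
Proof.
rewrite integral_nnsfun// patch_setT sintegralE.
transitivity (\int[mu]_x \sum_(y \in range h) (y%:E * ((\1_(h @^-1` [set y]) x)%:E * (f x)%:E))).
  rewrite ge0_integral_fsum//; last 2 first.
  - move=> y; apply: emeasurable_funM => //; apply: emeasurable_funM => //.
      by apply/measurable_EFinP; exact: measurable_indic.
    exact/measurable_EFinP.
  - move=> y x _; have [hx|hx] := eqVneq (h x) y.
      by rewrite -hx !mule_ge0// lee_fin// fun_ge0.
    rewrite indicE memNset ?mul0e ?mule0//= => e.
    by rewrite e eqxx in hx.
  apply: eq_fsbigr => y; rewrite inE => -[x _ <-].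
  rewrite ge0_integralZl//.
  - congr (_ * _); rewrite /density_measure [LHS]integral_mkcond.
    apply: eq_integral => t _; rewrite patchE indicE.
    by case: ifPn => th; rewrite ?mul1e ?mul0e.
  - apply: emeasurable_funM; first by apply/measurable_EFinP; exact: measurable_indic.
    exact/measurable_EFinP.
  - by move=> t _; rewrite mule_ge0// lee_fin.
  - by rewrite lee_fin fun_ge0.
apply: eq_integral => x _; rewrite [in RHS](fimfunE h x) -fsumEFin//.
rewrite ge0_mule_fsuml => [|y]; last exact: nnfun_muleindic_ge0.
by apply: eq_fsbigr => y _; rewrite EFinM muleA.
Qed.

(** Known for simple functions; both sides pass to the limit by monotone convergence along one
    approximating sequence. *)
Lemma ge0_integral_density (g : T -> \bar R) : measurable_fun setT g ->
  (forall x, 0 <= g x) -> \int[nu]_x g x = \int[mu]_x (g x * (f x)%:E).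
Proof.
move=> mg g0; pose h := nnsfun_approx measurableT mg.
have gE x : g x = lim ((EFin \o h n) x @[n --> \oo]).
  by apply/esym/cvg_lim => //; exact: cvg_nnsfun_approx.
transitivity (lim (\int[nu]_x (EFin \o h n) x @[n --> \oo])).
  under eq_integral do rewrite gE.
  apply: monotone_convergence => //.
  - by move=> n; exact/measurable_EFinP.
  - by move=> n x _ /=; rewrite lee_fin.
  - by move=> x _ a b ab; rewrite lee_fin; exact/lefP/nd_nnsfun_approx.
have gfE x : g x * (f x)%:E = lim (((h n x)%:E * (f x)%:E) @[n --> \oo]).
  by apply/esym/cvg_lim => //; apply: cvgeZr => //; exact: cvg_nnsfun_approx.
transitivity (lim (\int[mu]_x ((h n x)%:E * (f x)%:E) @[n --> \oo])).
  by under eq_fun do rewrite integral_density_nnsfun.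
under [RHS]eq_integral do rewrite gfE.
apply/esym; apply: monotone_convergence => //.
- move=> n; apply: emeasurable_funM; exact/measurable_EFinP.
- by move=> n x _ /=; rewrite mule_ge0// lee_fin.
- move=> x _ a b ab; rewrite lee_wpmul2r ?lee_fin//; exact/lefP/nd_nnsfun_approx.
Qed.

Lemma integral_density (D : set T) (g : T -> \bar R) : measurable D ->
  measurable_fun D g -> \int[nu]_(x in D) g x = \int[mu]_(x in D) (g x * (f x)%:E).
Proof.
move=> mD mg; rewrite [LHS]integral_mkcond [RHS]integral_mkcond.
have mgD : measurable_fun setT (g \_ D).
  by apply/(measurable_restrictT _ _).1.
rewrite [LHS]integralE [RHS]integralE.
rewrite ge0_integral_density; [|exact: measurable_funepos|by []].
rewrite ge0_integral_density; [|exact: measurable_funeneg|by []].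
congr (_ - _); apply: eq_integral => x _.
  rewrite !funeposE !patchE; case: ifPn => _; last by rewrite maxxx mul0e.
  by rewrite maxe_pMl ?lee_fin// mul0e.
rewrite !funenegE !patchE; case: ifPn => _; last by rewrite oppe0 maxxx mul0e.
by rewrite -mulNe maxe_pMl ?lee_fin// mul0e.
Qed.

End DensityMeasure.

(** * Disintegration of a joint density into probability kernels *)

Section JointDensity.
Local Open Scope ereal_scope.
Context {R : realType}.
Local Notation Rm := (measurableTypeR R).
Local Notation leb := (@lebesgue_measure R).
Local Notation leb2 := (@lebesgue_measure R \x @lebesgue_measure R).
Variable f : Rm * Rm -> R.
Hypothesis mf : measurable_fun setT f.
Hypothesis f0 : forall x, (0 <= f x)%R.
Hypothesis f1 : forall t, \int[leb]_x (f (x, t))%:E = 1.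

Let mslice t : measurable_fun setT (fun x : Rm => f (x, t)).
Proof. exact: measurableT_comp mf (measurable_pair2 t). Qed.

Let slice0 t x : (0 <= f (x, t))%R. Proof. exact: f0. Qed.

Definition slice_kernel (t : Rm) : {measure set Rm -> \bar R} :=
  density_measure leb (mslice t) (slice0 t).

Let setX_slice (A : set (Rm * Rm)) t :
  slice_kernel t (ysection A t) = \int[leb]_x ((\1_A (x, t))%:E * (f (x, t))%:E).
Proof.
rewrite /slice_kernel/= /density_measure integral_mkcond.
apply: eq_integral => x _; rewrite patchE indicE -mem_ysection.
by case: ifPn => h; rewrite ?mul1e ?mul0e.
Qed.

Let mAf (A : set (Rm * Rm)) : measurable A ->
  measurable_fun setT (fun z => (\1_A z)%:E * (f z)%:E).
Proof.
move=> mA; apply: emeasurable_funM; last exact/measurable_EFinP.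
by apply/measurable_EFinP; exact: measurable_indic.
Qed.

Let Af0 (A : set (Rm * Rm)) z : 0 <= (\1_A z)%:E * (f z)%:E.
Proof. by rewrite mule_ge0// lee_fin. Qed.

(** The mass that slice [t] gives to [U] is an inner Tonelli integral of [f] over [U] times the
    line, hence measurable in [t]. *)
Let measurable_slice_kernel U : measurable U ->
  measurable_fun [set: Rm] (slice_kernel ^~ U).
Proof.
move=> mU; have mUT : measurable (U `*` [set: Rm]) by exact: measurableX.
rewrite (_ : (fun _ => _) = fubini_G leb
  (fun z => (\1_(U `*` [set: Rm]) z)%:E * (f z)%:E)).
  by apply: measurable_fun_fubini_tonelli_G; [exact: mAf|exact: Af0].
apply/funext => t; rewrite /fubini_G -setX_slice (_ : ysection _ t = U)//.
by apply/seteqP; split => x; rewrite /ysection/= ?inE// => -[].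
Qed.

HB.instance Definition _ :=
  isKernel.Build _ _ Rm Rm R slice_kernel measurable_slice_kernel.

HB.instance Definition _ :=
  Kernel_isProbability.Build _ _ Rm Rm R slice_kernel f1.

Definition slice_pkernel : R.-pker Rm ~> Rm := slice_kernel.

Lemma slice_kernel_disintegration (A : set (Rm * Rm)) : measurable A ->
  density_measure leb2 mf f0 A = \int[leb]_t slice_kernel t (ysection A t).
Proof.
move=> mA; under eq_integral do rewrite setX_slice.
rewrite /density_measure integral_mkcond.
rewrite -(@fubini_tonelli2 _ _ _ _ _ leb leb
    (fun z => (\1_A z)%:E * (f z)%:E) (mAf mA) (@Af0 A)).
apply: eq_integral => z _; rewrite patchE indicE.
by case: ifPn => h; rewrite ?mul1e ?mul0e.
Qed.

End JointDensity.

(** * Chains of circles *)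

Section AffineChain.
Context {R : realType}.
Local Notation C := (Cplx R).
Local Notation Re := complex.Re.
Local Notation Im := complex.Im.
Local Notation Rm := (measurableTypeR R).
Local Notation leb := (@lebesgue_measure R).
Local Notation leb2 := (@lebesgue_measure R \x @lebesgue_measure R)%E.
Local Notation circ := (@circle R).
Local Notation cyl := (@cylinder R).

Let mcirc := @measurable_circle R.

Lemma measurable_cylinder : measurable cyl.
Proof. by apply: measurableX => //; exact: measurable_circle. Qed.

Variable a : R -> R.
Hypothesis ma : measurable_fun setT (a : Rm -> Rm).
Hypothesis a01 : forall t, 0 <= a t <= 1.

Definition cos_density (x : Rm * Rm) : R := 1 + a x.2 * cos x.1.

Lemma measurable_cos_density : measurable_fun setT cos_density.
Proof.
apply: measurable_funD => //; apply: measurable_funM.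
  exact: measurableT_comp ma measurable_snd.
apply: measurableT_comp measurable_fst.
by apply: continuous_measurable_fun; exact: continuous_cos.
Qed.

Lemma cos_density_ge0 x : 0 <= cos_density x.
Proof.
rewrite /cos_density; have /andP[a0 a1] := a01 x.2.
by have := cos_geN1 x.1; have := cos_le1 x.1; nra.
Qed.

(** Density with respect to Lebesgue measure on the plane: the factor [1 / (2 pi)] of the reference
    measure and the restriction to the cylinder are built in. *)
Let f (x : Rm * Rm) : R := \1_cyl x * (cos_density x / (2 * pi)).

Let mf : measurable_fun setT f.
Proof.
apply: measurable_funM; first exact: measurable_indic measurable_cylinder.
by apply: measurable_funM => //; exact: measurable_cos_density.
Qed.

Let pi2 : 0 < 2 * pi :> R. Proof. by rewrite mulr_gt0// pi_gt0. Qed.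

Let f0 x : 0 <= f x.
Proof. by rewrite mulr_ge0// divr_ge0 ?cos_density_ge0// ltW. Qed.

Let fE x t : f (x, t) = \1_circ x * ((1 + a t * cos x) / (2 * pi)).
Proof.
by rewrite /f !indicE /cyl in_setX in_setT andbT.
Qed.

Lemma integral_circle_1Dcos c :
  (\int[leb]_(x in circ) (1 + c * cos x)%:E)%E = (2 * pi)%:E.
Proof.
have dF (x : R) : is_derive x (1 : R) (fun x => x + c * sin x) (1 + c * cos x).
  by apply: is_derive_eq.
rewrite (ftc_itvco (ltW pi2) dF); last exact: continuous_1Dacos.
by rewrite mulr_natl sin2pi sin0; congr EFin; ring.
Qed.

Let f1 t : (\int[leb]_x (f (x, t))%:E)%E = 1%E.
Proof.
transitivity (\int[leb]_(x in circ) ((2 * pi)^-1%:E * (1 + a t * cos x)%:E))%E.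
  rewrite [RHS]integral_mkcond; apply: eq_integral => x _.
  rewrite fE patchE indicE; case: ifPn => _; last by rewrite mul0r.
  by rewrite mul1r mulrC EFinM.
rewrite integralZl//; last first.
  by apply: continuous_integrable_circle; exact: continuous_1Dacos.
by rewrite integral_circle_1Dcos -EFinM mulVf// gt_eqF.
Qed.

Definition cos_measure : {measure set (Rm * Rm) -> \bar R} :=
  density_measure leb2 mf f0.

Let k : R.-pker Rm ~> Rm := slice_pkernel mf f0 f1.

Lemma is_density_cos_measure : is_density cos_measure cos_density.
Proof.
split; [exact: measurable_cos_density|exact: cos_density_ge0|] => A mA.
rewrite /cos_measure/= /density_measure [RHS]integral_mkcondr.
apply: eq_integral => x _; rewrite patchE /f indicE.
by case: ifPn => _; rewrite ?mul1r ?mul0r.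
Qed.

Let kE t : k t = density_measure leb _ _ :> (set Rm -> \bar R) := erefl.

Let k_circ t : k t circ = 1%E.
Proof.
rewrite -(f1 t) kE /density_measure integral_mkcond; apply: eq_integral => x _.
by rewrite patchE; case: ifPn => // h; rewrite fE indicE (negbTE h) mul0r.
Qed.

Let k_disintegration : disintegration cos_measure k.
Proof.
split; first exact: k_circ.
by move=> A mA; exact: (slice_kernel_disintegration mf f0 mA).
Qed.

Lemma loewner_class_cos_measure : loewner_class cos_measure.
Proof.
split.
  rewrite /cos_measure/= /density_measure; apply: integral0_eq => x cx.
  by rewrite /f indicE memNset// mul0r.
move=> I; rewrite k_disintegration.2; last exact: measurableX.
rewrite -[RHS]mul1e -integral_cst// [RHS]integral_mkcond.
apply: eq_integral => t _; rewrite patchE.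
case: ifPn => tI.
  rewrite -(k_circ t); congr (k t _); apply/seteqP; split => x; rewrite /ysection/= ?inE.
    by case.
  by move=> cx; split => //; move: tI; rewrite inE.
rewrite (_ : ysection _ t = set0) ?measure0//.
by rewrite -subset0 => x; rewrite /ysection/= inE => -[_ /= tI']; move: tI; rewrite notin_setE.
Qed.

Let Rintegral_kernel t (g : R -> R) : continuous g ->
  \int[k t]_(x in circ) g x =
  (2 * pi)^-1 * \int[leb]_(x in circ) (g x * (1 + a t * cos x)).
Proof.
move=> cg; have cgf : continuous (fun x => g x * (1 + a t * cos x)).
  by move=> x; apply: cvgM; [exact: cg|exact: continuous_1Dacos].
have mg : measurable_fun circ (EFin \o g).
  by apply/measurable_EFinP/measurable_funTS; exact: continuous_measurable_fun.
rewrite -RintegralZl//; last exact: continuous_integrable_circle.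
rewrite /Rintegral (integral_density _ _ _ mcirc mg); congr fine.
apply: eq_integral => x xc.
rewrite fE indicE xc mul1r -EFinM; congr EFin.
have alg (p q s : R) : p * (q * s) = s * (p * q) by ring.
exact: alg.
Qed.

(** Dividing by [z] rewrites the kernel with [w = 1 / z], which lies in the unit disc, so
    [herglotz_mean] applies. *)
Lemma herglotz_cos_measure t (z : C) : 1 < `|z| ->
  herglotz k t z = 1 + (a t)%:C / z.
Proof.
move=> z1.
have sz : 1 < sqdist 0 z by have := @gtc_normP R z 1 ler01; rewrite expr1n /sqdist subr0 => <-.
have z0 : z != 0 by apply: contraTneq sz => ->; rewrite -leNgt /sqdist/= subr0 expr0n addr0.
have sw : sqdist 0 (z^-1 : C) < 1.
  have := sqdist0M z (z^-1); rewrite divff// => e.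
  have e1 : sqdist 0 (1 : C) = 1 by rewrite /sqdist/= subr0 expr1n expr0n addr0.
  have q0 : 0 <= sqdist 0 (z^-1 : C) by rewrite addr_ge0// sqr_ge0.
  rewrite e1 in e; nra.
have := herglotz_mean sw (a t).
have eH x : (1 + z^-1 * expi x) / (1 - z^-1 * expi x) = (z + expi x) / (z - expi x) :> R[i].
  have := one_minus_expi_neq0 sw x => h.
  have h' : z - expi x != 0.
    by apply: contraNneq h => h; rewrite -(mulVf z0) -mulrBr h mulr0.
  by field; rewrite ?h' ?z0.
have cden : continuous (fun x => z - expi x : C).
  move=> x; apply: (@cvgD _ _ _ (nbhs x)); first exact: cvg_cst.
  by apply: (@cvgN _ _ _ (nbhs x)); exact: continuous_expi.
have cH : continuous (fun x => (z + expi x) / (z - expi x) : C).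
  move=> x; apply: (@cvgM R[i] _ (nbhs x)).
    by apply: (@cvgD _ _ _ (nbhs x)); [exact: cvg_cst|exact: continuous_expi].
  apply: (@cvgV R[i] _ (nbhs x)).
    apply: contraNneq (one_minus_expi_neq0 sw x) => h.
    by rewrite -(mulVf z0) -mulrBr h mulr0.
  exact: cden.
pose p : C := (2 * pi)%:C.
have p0 : p != 0 by rewrite eq_complex/= negb_and gt_eqF.
have -> : herglotz k t z = p^-1 * cintegral leb circ (fun x =>
    (z + expi x) / (z - expi x) * (1 + a t * cos x)%:C).
  have pV : p^-1 = ((2 * pi)^-1)%:C.
    by rewrite /p fmorphV.
  rewrite pV; apply: complex_ext; rewrite ?cReM ?cImM /= mul0r ?subr0 ?addr0.
    rewrite Rintegral_kernel; last exact: (continuous_Re_comp cH).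
    congr (_ * _); apply: eq_Rintegral => x _.
    by rewrite [in RHS]cReM /= mulr0 subr0.
  rewrite Rintegral_kernel; last exact: (continuous_Im_comp cH).
  congr (_ * _); apply: eq_Rintegral => x _.
  by rewrite [in RHS]cImM /= mulr0 add0r.
have -> : (fun x => (z + expi x) / (z - expi x) * (1 + a t * cos x)%:C) =
    (fun x => (1 + z^-1 * expi x) / (1 - z^-1 * expi x) * (1 + a t * cos x)%:C) :> (Rm -> C).
  by apply/funext => x; congr (_ * _); exact/esym/eH.
by rewrite herglotz_mean// mulrA mulVf// mul1r.
Qed.

Variable c : R -> R.
Hypothesis ac : forall s t, s <= t ->
  leb.-integrable `[s, t] (EFin \o (fun u => a u * expR u)) /\
  \int[leb]_(u in `[s, t]) (a u * expR u) = c t - c s.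
Hypothesis c0 : c t @[t --> -oo] --> (0 : R).

(** [a] and [c] are tied only through integrals, since the profiles used later jump at time 0, where
    the center stops moving. *)
Definition affine_chain (t : R) : C -> C := affine (expR t) (c t).

(** [z F_u'(z) p_u(z) = z e^u (1 + a / z) = e^u z + a e^u], whose integral splits into the growth of
    the radius and the motion of the center. *)
Let affine_chain_ode (z : C) (s t : R) : exterior_disc z -> s <= t ->
  let v := fun u : Rm => z * 'D_1 (affine_chain u) z * herglotz k u z in
  cintegrable leb `[s, t] v /\
  affine_chain t z - affine_chain s z = cintegral leb `[s, t] v.
Proof.
move=> z1 st v.
have z0 : z != 0 by rewrite -normr_gt0; apply: lt_trans z1; exact: ltr01.
have vE u : v u = (expR u)%:C * z + (a u * expR u)%:C.
  rewrite /v herglotz_cos_measure//.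
  have [_ ->] := is_derive_affine (expR u) (c u) z.
  rewrite (_ : (a u * expR u)%:C = (a u)%:C * (expR u)%:C) ?rmorphM//.
  move: (expR u)%:C (a u)%:C => p q.
  change (z * p * (1 + q / z) = p * z + q * p :> R[i]).
  by field.
have vR u : Re (v u) = expR u * Re z + a u * expR u.
  by rewrite vE cReD cReM /= mul0r subr0.
have vI u : Im (v u) = expR u * Im z.
  by rewrite vE cImD cImM /= mul0r !addr0.
have [ia ea] := ac st.
have ce (q : R) : continuous (fun u => expR u * q).
  by move=> u; apply: cvgMr_tmp; exact: continuous_expR.
have iexp (q : R) : leb.-integrable `[s, t] (EFin \o (fun u => expR u * q)).
  exact: continuous_integrable_itvcc.
have eexp (q : R) : \int[leb]_(u in `[s, t]) (expR u * q) = (expR t - expR s) * q.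
  have dF (x : R) : is_derive x (1 : R) (fun u => expR u * q) (expR x * q).
    by apply: is_derive_eq; rewrite /GRing.scale/= mulr0 add0r mulrC.
  by rewrite /Rintegral (ftc_itvcc st dF (ce q)) /= mulrBl.
split.
  split.
    rewrite (_ : (fun x => _) =
        (fun x : R => (expR x * Re z)%:E + (a x * expR x)%:E)%E).
      by apply: (integrableD _ (iexp (Re z)) ia).
    by apply/funext => u; rewrite vR.
  rewrite (_ : (fun x => _) = EFin \o (fun u => expR u * Im z)); first exact: iexp.
  by apply/funext => u; rewrite vI.
apply: complex_ext => /=.
  rewrite (_ : (fun x => Re (v x)) = (fun u => expR u * Re z + a u * expR u)); last first.
    by apply/funext => u; exact: vR.
  rewrite RintegralD// ea eexp cReB /affine_chain /affine !cReD !cReM /=; ring.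
rewrite (_ : (fun x => Im (v x)) = (fun u => expR u * Im z)); last first.
  by apply/funext => u; exact: vI.
by rewrite eexp cImB /affine_chain /affine !cImD !cImM /=; ring.
Qed.

Lemma cvg_expR_Ny : expR t @[t --> -oo] --> (0 : R).
Proof.
apply/cvgrPdist_lt => e e0; near=> t.
rewrite sub0r normrN ger0_norm ?expR_ge0// -(@lnK R e) ?posrE// ltr_expR.
by near: t; apply: nbhs_ninfty_lt; rewrite num_real.
Unshelve. all: by end_near. Qed.

(** Center and radius both shrink to 0, so a nonzero [z] is outside the hull for early times; there
    the inverse is [(z - c(t)) / e^t], and rescaling leaves [z - c(t)]. *)
Let affine_chain_init (z : C) : z != 0 ->
  (\forall t \near -oo, (affine_chain t @` exterior_disc) z) /\
  ((expR t)%:C * 'pinv_(fun=> 0) exterior_disc (affine_chain t) z)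
    @[t --> -oo] --> z.
Proof.
move=> z0; have h : \forall t \near -oo, (affine_chain t @` exterior_disc) z.
  have sz : 0 < sqdist 0 z.
    rewrite lt_neqAle addr_ge0 ?sqr_ge0// andbT eq_sym.
    rewrite paddr_eq0 ?sqr_ge0// !sqrf_eq0 subr0; apply: contraNN z0.
    by move=> /andP[/eqP h1 /eqP h2]; apply/eqP/complex_ext.
  have cv : sqdist (c t) z - expR t ^+ 2 @[t --> -oo] --> sqdist 0 z - 0 ^+ 2.
    rewrite /sqdist; under eq_fun do rewrite !expr2.
    rewrite !expr2; apply: cvgB; last by apply: cvgM; exact: cvg_expR_Ny.
    apply: cvgD; last exact: cvg_cst.
    by apply: cvgM; apply: cvgB => //; exact: cvg_cst.
  rewrite expr0n subr0 in cv.
  near=> t; rewrite /affine_chain affine_exterior ?expR_gt0//= -subr_gt0.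
  by near: t; exact: (cvgr_gt _ cv).
split => //.
(* [pinv] is a true inverse only on the image, so the formula is used only for [t] near -oo. *)
apply: (@cvg_trans _ ((fun t => z - (c t)%:C : C) @ -oo)).
  apply: near_eq_cvg; near=> t.
  have zt : (affine_chain t @` exterior_disc) z by near: t.
  have := pinvK (fun=> 0) (mem_set zt); rewrite {1}/affine_chain /affine => e.
  by rewrite -{1}e addrK.
apply: complex_cvg_ReIm => /=.
  under eq_fun do rewrite cReB /=.
  have cR : Re z - c t @[t --> -oo] --> Re z - 0 by apply: cvgB => //; exact: cvg_cst.
  by rewrite subr0 in cR.
under eq_fun do rewrite cImB /= subr0.
exact: cvg_cst.
Unshelve. all: by end_near. Qed.

Lemma whole_plane_chain_affine : whole_plane_chain cos_measure affine_chain.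
Proof.
exists k; split => //.
by move=> t; apply: exterior_map_affine; exact: expR_gt0.
Qed.

End AffineChain.

(** * Entropy *)

Section EntropyOfDensity.
Context {R : realType}.
Local Notation Rm := (measurableTypeR R).
Local Notation leb := (@lebesgue_measure R).
Local Notation leb2 := (@lebesgue_measure R \x @lebesgue_measure R)%E.
Local Notation circ := (@circle R).
Local Notation cyl := (@cylinder R).
Implicit Types (rho : {measure set (Rm * Rm) -> \bar R}) (d : Rm * Rm -> R).

Let pi2 : 0 < 2 * pi :> R. Proof. by rewrite mulr_gt0// pi_gt0. Qed.

Let mcyl := @measurable_cylinder R.

Lemma measure_circle : leb circ = (2 * pi)%:E.
Proof. by rewrite /circle lebesgue_measure_itv/= lte_fin pi2 -EFinB subr0. Qed.

(** [entropy] evaluates a density picked by [get], so that density has to be compared with the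
    explicit one. Both have the same integral over every measurable set, and the bound on [d'] gives
    integrability on pieces of finite measure that exhaust the cylinder. *)
Lemma density_ae_eq rho d d' (M : R) : is_density rho d -> is_density rho d' ->
  (forall x, d' x <= M) -> ae_eq leb2 cyl d d'.
Proof.
move=> [md d0 dE] [md' d0' dE'] dM.
pose D (n : nat) : set (Rm * Rm) := circ `*` `[- n%:R, n%:R].
have mD n : measurable (D n) by apply: measurableX => //; exact: measurable_circle.
have Dcyl n : D n `<=` cyl by move=> x [].
have mdiv (e : Rm * Rm -> R) A : measurable_fun setT e ->
    measurable_fun A (fun x => (e x / (2 * pi))%:E).
  by move=> me; apply/measurable_EFinP/measurable_funTS; apply: measurable_funM.
have h n : ae_eq leb2 (D n) (fun x => (d' x / (2 * pi))%:E)
    (fun x => (d x / (2 * pi))%:E).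
  apply: integral_ae_eq => //; last 2 first.
  - exact: mdiv.
  - move=> E ED mE; have := dE' _ mE; rewrite (dE _ mE).
    by rewrite (setIidl (subset_trans ED (Dcyl n))).
  apply: measurable_bounded_integrable => //.
  - rewrite [ltLHS](product_measure1E leb leb)//; last exact: measurable_circle.
    rewrite [X in (X * _)%E](_ : _ = (2 * pi)%:E); last exact: measure_circle.
    rewrite [X in (_ * X)%E]lebesgue_measure_itv/= lte_fin.
    by case: ifP => _; rewrite ?mule0// -EFinM ltry.
  - by apply: measurable_funM => //; exact: measurable_funTS.
  - exists (M / (2 * pi)); split; first exact: num_real.
    move=> x Mx y _ /=; rewrite ger0_norm ?divr_ge0 ?(ltW pi2)//.
    by apply: le_trans (ltW Mx); rewrite ler_pM2r// invr_gt0.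
have hN : leb2.-negligible (\bigcup_n
    ~` [set x | D n x -> (d' x / (2 * pi))%:E = (d x / (2 * pi))%:E]).
  by apply: negligible_bigcup => n; exact: h.
change (leb2.-negligible (~` [set x | cyl x -> d x = d' x])).
apply: negligibleS hN => x /= /not_implyP[[cx _] nx].
exists (Num.truncn `|x.2|).+1 => //=; apply/not_implyP; split.
  split => //=; rewrite in_itv/= -ler_norml.
  by apply/ltW/truncnS_gt.
move=> [] /(mulIf _) e; apply: nx; apply/esym/e.
by rewrite invr_neq0// gt_eqF.
Qed.

Lemma measurable_entropy_integrand d : measurable_fun setT d ->
  measurable_fun setT (entropy_integrand d).
Proof.
move=> md; apply/measurable_EFinP; apply: measurable_funM => //.
exact: measurableT_comp.
Qed.

(** Almost everywhere equality carries both the integral and the condition that it is defined from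
    [d] to the density picked by [get]. *)
Lemma entropyE rho d (M : R) : is_density rho d -> (forall x, d x <= M) ->
  leb2.-integrable cyl (entropy_integrand d) ->
  entropy rho = ((2 * pi)^-1%:E * \int[leb2]_(x in cyl) entropy_integrand d x)%E.
Proof.
move=> rd dM id; rewrite /entropy; set e := get _.
have re : is_density rho e by apply: (@getPex _ (is_density rho)); exists d.
have ed := density_ae_eq re rd dM.
have [[me _ _] [md _ _]] := (re, rd).
have mie : measurable_fun cyl (entropy_integrand e).
  by apply: measurable_funTS; exact: measurable_entropy_integrand.
have mid : measurable_fun cyl (entropy_integrand d).
  by apply: measurable_funTS; exact: measurable_entropy_integrand.
have aee : ae_eq leb2 cyl (entropy_integrand e) (entropy_integrand d).
  exact: (ae_eq_comp (fun y => (y * ln y)%:E) ed).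
have [aep aen] := (ae_eq_funeposneg leb2 cyl _ _).1 aee.
have ip := integrable_funepos mcyl id.
have iN := integrable_funeneg mcyl id.
case: asboolP => [_|[]].
  by congr (_ * _)%E; exact: ae_eq_integral.
split => //; rewrite /entropy_integral_defined.
rewrite (ae_eq_integral _ _ _ _ _ aep) ?(ae_eq_integral _ _ _ _ _ aen)//.
- by rewrite fin_num_adde_defr//; exact: integrable_fin_num.
- exact: measurable_funeneg.
- exact: measurable_funeneg.
- exact: measurable_funepos.
- exact: measurable_funepos.
Qed.

Section CylinderIntegrals.
Variables (g : Rm * Rm -> R) (b : Rm -> R).
Hypothesis mg : measurable_fun setT g.
Hypothesis ib : leb.-integrable setT (EFin \o b).
Hypothesis gb : forall x t, `|g (x, t)| <= b t.

(** Extension by zero to the plane, so that Fubini applies on a full product. *)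
Let gc (x : Rm * Rm) : \bar R := ((\1_cyl x)%:E * (g x)%:E)%E.

Let mgc : measurable_fun setT gc.
Proof.
by apply: emeasurable_funM; apply/measurable_EFinP => //; exact: measurable_indic.
Qed.

Let gcE x t : gc (x, t) = (((fun y => (g (y, t))%:E) \_ circ) x)%E.
Proof.
rewrite /gc indicE in_setX in_setT andbT patchE.
by case: ifPn => _; rewrite ?mul1e ?mul0e.
Qed.

Let b0 t : 0 <= b t. Proof. exact: le_trans (normr_ge0 _) (gb 0 t). Qed.

(** A majorant depending on [t] alone suffices because the circle has finite length. *)
Let igc : leb2.-integrable setT gc.
Proof.
apply/integrableP; split => //.
have mag : measurable_fun setT (abse \o gc) by exact: measurableT_comp.
have ag0 x : (0 <= (abse \o gc) x)%E by exact: abse_ge0.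
rewrite (@fubini_tonelli2 _ _ _ _ _ leb leb _ mag ag0).
apply: (@le_lt_trans _ _ (\int[leb]_t ((2 * pi)%:E * (b t)%:E))%E).
  apply: ge0_le_integral => //.
  - by move=> t _; apply: integral_ge0 => x _.
  - exact: measurable_fun_fubini_tonelli_G.
  - by apply: emeasurable_funM => //; exact: measurable_int ib.
  - move=> t _; rewrite /fubini_G.
    apply: (@le_trans _ _ (\int[leb]_(x in circ) (b t)%:E)%E).
      rewrite [leRHS]integral_mkcond; apply: ge0_le_integral => //.
      + exact: measurableT_comp mag (measurable_pair2 t).
      + by apply/(measurable_restrictT _ _).1 => //; exact: measurable_circle.
      + move=> x _; change (`|gc (x, t)| <= ((fun=> (b t)%:E) \_ circ) x)%E.
        rewrite gcE !patchE; case: ifPn => _; last by rewrite abse0.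
        by rewrite lee_fin.
    rewrite integral_cst; last exact: measurable_circle.
    by rewrite [X in (_ * X <= _)%E]measure_circle muleC.
rewrite integralZl// lte_mul_pinfty ?lee_fin ?(ltW pi2)//.
case/integrableP : ib => _.
rewrite (_ : (fun t => `|(EFin \o b) t|)%E = EFin \o b)//.
by apply/funext => t /=; rewrite ger0_norm.
Qed.

Lemma integrable_cylinder : leb2.-integrable cyl (EFin \o g).
Proof.
apply/(integrable_mkcond _ mcyl).
rewrite (_ : _ \_ _ = gc)//; apply/funext => x; rewrite patchE /gc indicE.
by case: ifPn => _; rewrite ?mul1e ?mul0e.
Qed.

Lemma integral_cylinder :
  (\int[leb2]_(x in cyl) (g x)%:E = \int[leb]_t \int[leb]_(x in circ) (g (x, t))%:E)%E.
Proof.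
transitivity (\int[leb2]_x gc x)%E.
  rewrite integral_mkcond; apply: eq_integral => x _; rewrite patchE /gc indicE.
  by case: ifPn => _; rewrite ?mul1e ?mul0e.
rewrite -(integral21_prod_meas1 igc); apply: eq_integral => t _.
rewrite [RHS]integral_mkcond; apply: eq_integral => x _; exact: gcE.
Qed.

End CylinderIntegrals.

End EntropyOfDensity.

(** * Strict comparison of entropies by the tangent inequality *)

Section EntropyComparison.
Context {R : realType}.
Local Notation Rm := (measurableTypeR R).
Local Notation leb := (@lebesgue_measure R).
Local Notation leb2 := (@lebesgue_measure R \x @lebesgue_measure R)%E.
Local Notation circ := (@circle R).
Local Notation cyl := (@cylinder R).

Let mcyl := @measurable_cylinder R.
Let mcirc := @measurable_circle R.
Let pi2 : 0 < 2 * pi :> R. Proof. by rewrite mulr_gt0// pi_gt0. Qed.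

(** The bound is linear in [a], so the entropy integrand inherits integrability over infinite time
    from the profile; [m < 1] keeps the logarithm away from its singularity. *)
Lemma ln1D_bound (m a x : R) : m < 1 -> 0 <= a <= m -> `|x| <= a ->
  `|ln (1 + x)| <= a / (1 - m).
Proof.
move=> m1 /andP[a0 am]; rewrite ler_norml => /andP[xa ax].
have x1 : 0 < 1 + x by lra.
have m0 : 0 < 1 - m by rewrite subr_gt0.
have am0 : a <= a / (1 - m) by rewrite ler_pdivlMr//; nra.
rewrite ler_norml; apply/andP; split; last first.
  apply: le_trans am0; apply: le_trans ax; apply: le_ln1Dx; lra.
rewrite lerNl -lnV ?posrE//.
(* The lower bound is [ln (1 + y) <= y] applied to the reciprocal. *)
have -> : (1 + x)^-1 = 1 + (- x / (1 + x)) by field; rewrite gt_eqF.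
apply: (@le_trans _ _ (- x / (1 + x))).
  by apply: le_ln1Dx; rewrite ltr_pdivlMr//; lra.
rewrite ler_pdivrMr// mulrAC ler_pdivlMr//; nra.
Qed.

(** Strict convexity of [x ln x], equivalent to [1 + v < e^v] at [v = ln (y / x)]. *)
Lemma xlnx_tangent_lt (x y : R) : 0 < x -> 0 < y -> x != y ->
  y * ln y + (x - y) * (ln y + 1) < x * ln x.
Proof.
move=> x0 y0 xy.
have yx0 : 0 < y / x by rewrite divr_gt0.
have l0 : ln (y / x) != 0.
  rewrite ln_eq0//; apply: contraNneq xy => e.
  have yE : y / x * x = y by rewrite divfK// gt_eqF.
  by rewrite -yE e mul1r.
have := expR_gt1Dx l0; rewrite lnK ?posrE// ln_div ?posrE// ltr_pdivlMr//; nra.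
Qed.

Lemma integral_cos : (\int[leb]_(x in circ) (cos x)%:E = 0)%E.
Proof.
rewrite (ftc_itvco (ltW pi2) (fun x => @is_derive_sin R x)) ?mulr_natl.
  by rewrite sin2pi sin0 subrr.
exact: continuous_cos.
Qed.

Section Bounds.
Variables (a b : R -> R) (m : R).
Hypothesis ma : measurable_fun setT (a : Rm -> Rm).
Hypothesis m1 : m < 1.
Hypothesis am : forall t, 0 <= a t <= m.
Hypothesis ab : forall t, a t <= b t.
Hypothesis ib : leb.-integrable setT (EFin \o (b : Rm -> R)).

Lemma acos_le t x : `|a t * cos x| <= a t.
Proof.
have /andP[a0 _] := am t.
by rewrite normrM ger0_norm// ler_piMr// cos_max.
Qed.

Lemma cos_density_gt0 x : 0 < cos_density a x.
Proof.
apply: cos_pos_gt0; have /andP[a0 a1] := am x.2; rewrite a0/=.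
exact: le_lt_trans a1 m1.
Qed.

Lemma integrable_entropy_cos :
  leb2.-integrable cyl (entropy_integrand (cos_density a)).
Proof.
have m0 : 0 < 1 - m by rewrite subr_gt0.
(* The density is at most 2 and its logarithm at most [a / (1 - m)] in absolute value. *)
apply: (@integrable_cylinder _ _ (fun t => 2 / (1 - m) * b t)).
- have := measurable_entropy_integrand (measurable_cos_density ma).
  by move/measurable_EFinP.
- exact: (integrableZl measurableT _ ib).
- move=> x t; rewrite normrM.
  have /andP[a0 a1] := am t; have := acos_le t x.
  rewrite /cos_density/= => ac; have lb := ln1D_bound m1 (am t) ac.
  have d0 := cos_density_gt0 (x, t); rewrite /cos_density/= in d0.
  rewrite ger0_norm ?(ltW d0)//.
  apply: (@le_trans _ _ (2 * (a t / (1 - m)))).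
    apply: ler_pM => //; first exact: ltW.
    move: ac; rewrite ler_norml => /andP[_ ac]; lra.
  by rewrite mulrA mulrAC ler_wpM2l// divr_ge0// ltW.
Qed.

End Bounds.

Section Comparison.
Variables (a1 a2 b beta : R -> R) (m s1 s2 : R).
Hypothesis ma1 : measurable_fun setT (a1 : Rm -> Rm).
Hypothesis ma2 : measurable_fun setT (a2 : Rm -> Rm).
Hypothesis mbeta : measurable_fun setT (beta : Rm -> Rm).
Hypothesis m1 : m < 1.
Hypothesis am1 : forall t, 0 <= a1 t <= m.
Hypothesis am2 : forall t, 0 <= a2 t <= m.
Hypothesis ab1 : forall t, a1 t <= b t.
Hypothesis ab2 : forall t, a2 t <= b t.
Hypothesis ib : leb.-integrable setT (EFin \o (b : Rm -> R)).
Hypothesis beta01 : forall t, 0 <= beta t < 1.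
Hypothesis a1E : forall t, a1 t = 2 * beta t / (1 + beta t ^+ 2).
Hypothesis orth : (\int[leb]_t ((a2 t - a1 t) * beta t)%:E = 0)%E.
Hypothesis s12 : s1 < s2.
Hypothesis a12 : forall t, s1 < t < s2 -> a1 t != a2 t.

Let e1 (x : Rm * Rm) : R := cos_density a1 x * ln (cos_density a1 x).
Let e2 (x : Rm * Rm) : R := cos_density a2 x * ln (cos_density a2 x).
(** [L] is the linear term of the tangent to [x ln x] at the first density, evaluated at the second;
    [D] is the remainder, nonnegative by convexity. *)
Let L (x : Rm * Rm) : R :=
  (a2 x.2 - a1 x.2) * (cos x.1 * ln (1 + a1 x.2 * cos x.1) + cos x.1).
Let D x := e2 x - e1 x - L x.

Let DE x : D x = cos_density a2 x * ln (cos_density a2 x) -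
  (cos_density a1 x * ln (cos_density a1 x) +
  (cos_density a2 x - cos_density a1 x) * (ln (cos_density a1 x) + 1)).
Proof. by rewrite /D /e1 /e2 /L /cos_density; ring. Qed.

Let D_gt0 x : cos_density a2 x != cos_density a1 x -> 0 < D x.
Proof.
move=> dd; rewrite DE subr_gt0.
by apply: xlnx_tangent_lt => //; [exact: cos_density_gt0 m1 am2 x|exact: cos_density_gt0 m1 am1 x].
Qed.

Let D_ge0 x : 0 <= D x.
Proof.
have [e|/D_gt0/ltW//] := eqVneq (cos_density a2 x) (cos_density a1 x).
by rewrite DE e subrr mul0r addr0 subrr.
Qed.

Let m0 : 0 < 1 - m. Proof. by rewrite subr_gt0. Qed.

Let a21 t : `|a2 t - a1 t| <= b t.
Proof.
have := am1 t; have := am2 t; have := ab1 t; have := ab2 t.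
move=> b2 b1 /andP[p2 q2] /andP[p1 q1].
by rewrite ler_norml; apply/andP; split; lra.
Qed.

Let mL : measurable_fun setT L.
Proof.
have mc : measurable_fun setT (fun x : Rm * Rm => cos x.1 : R).
  by apply: measurableT_comp measurable_fst;
    apply: continuous_measurable_fun; exact: continuous_cos.
apply: measurable_funM.
  by apply: measurable_funB; [exact: measurableT_comp ma2 measurable_snd|
    exact: measurableT_comp ma1 measurable_snd].
apply: measurable_funD => //; apply: measurable_funM => //.
by apply: measurableT_comp => //; exact: measurable_cos_density.
Qed.

Let LB x t : `|L (x, t)| <= (m / (1 - m) + 1) * b t.
Proof.
have /andP[p1 q1] := am1 t; have mm : 0 <= m := le_trans p1 q1.
have mm0 : 0 <= m / (1 - m) by rewrite divr_ge0// ltW.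
rewrite /L normrM mulrC; apply: ler_pM => //.
apply: (le_trans (ler_normD _ _)); apply: lerD; last exact: cos_max.
rewrite normrM -[leRHS]mul1r; apply: ler_pM => //; first exact: cos_max.
apply: ln1D_bound => //; first by rewrite mm lexx.
by apply: le_trans q1; exact: acos_le am1 t x.
Qed.

Let ibZ (r : R) : leb.-integrable setT (EFin \o (fun t : Rm => r * b t)).
Proof. exact: (integrableZl measurableT _ ib). Qed.

Let iL : leb2.-integrable cyl (EFin \o L).
Proof. exact: (integrable_cylinder mL (ibZ _) LB). Qed.

(** On each circle the mean of [L] is [(a2 - a1) beta], by [integral_cosln]; the time integral of
    that vanishes by [orth]. *)
Let integral_L : (\int[leb2]_(x in cyl) (L x)%:E = 0)%E.
Proof.
rewrite (integral_cylinder mL (ibZ _) LB).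
transitivity (\int[leb]_t ((2 * pi)%:E * ((a2 t - a1 t) * beta t)%:E))%E.
  apply: eq_integral => t _.
  have cL : continuous (fun x => cos x * ln (1 + a1 t * cos x)).
    move=> x; apply: cvgM; first exact: continuous_cos.
    apply: continuous_ln1Dacos; have /andP[-> /=] := am1 t.
    by move=> /le_lt_trans; exact.
  have icos := continuous_integrable_circle (@continuous_cos R).
  have icL := continuous_integrable_circle cL.
  transitivity (\int[leb]_(x in circ) ((a2 t - a1 t)%:E *
      ((cos x * ln (1 + a1 t * cos x))%:E + (cos x)%:E)))%E.
    by apply: eq_integral => x _; rewrite -EFinD -EFinM.
  rewrite integralZl//; last exact: integrableD.
  rewrite integralD// integral_cos adde0.
  (* [integral_cosln] asks for a positive parameter. Where [beta] vanishes so does [a1], and the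
     logarithm is 0. *)
  have := beta01 t; rewrite le_eqVlt => /andP[/predU1P[b0|b0] b1].
    rewrite a1E -b0 !mulr0 mul0r.
    under eq_integral do rewrite mul0r addr0 ln1 mulr0.
    by rewrite integral0 !mule0.
  rewrite a1E integral_cosln ?b0//.
  by rewrite -!EFinM; congr EFin; ring.
rewrite integralZl//; first by rewrite orth mule0.
apply: le_integrable ib => //.
  apply/measurable_EFinP; apply: measurable_funM => //; exact: measurable_funB.
move=> t _; rewrite lee_fin normrM.
have /andP[p q] := beta01 t.
have bb : 0 <= b t := le_trans (normr_ge0 _) (a21 t).
rewrite (ger0_norm bb) (ger0_norm p) -[leRHS]mulr1; apply: ler_pM => //; exact: ltW.
Qed.

Let ie1 : leb2.-integrable cyl (EFin \o e1).
Proof. exact: integrable_entropy_cos ma1 m1 am1 ab1 ib. Qed.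

Let ie2 : leb2.-integrable cyl (EFin \o e2).
Proof. exact: integrable_entropy_cos ma2 m1 am2 ab2 ib. Qed.

Let iD : leb2.-integrable cyl (EFin \o D).
Proof. exact: (integrableB mcyl (integrableB mcyl ie2 ie1) iL). Qed.

Let integral_D_gt0 : (0 < \int[leb2]_(x in cyl) (D x)%:E)%E.
Proof.
rewrite lt_neqAle integral_ge0 ?andbT => [|x _]; last by rewrite lee_fin.
apply/eqP => /esym i0.
have mD : measurable_fun cyl (EFin \o D) := measurable_int _ iD.
have /(ae_eq_integral_abs _ mcyl mD) : (\int[leb2]_(x in cyl) `|(EFin \o D) x| = 0)%E.
  rewrite -i0; apply: eq_integral => x _ /=.
  by rewrite ger0_norm.
move=> aeD; have nD : leb2.-negligible (~` [set x | cyl x -> (D x)%:E = 0%E] ) := aeD.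
(* For [0 <= x < 1 <= pi / 2] the cosine is positive, so different profiles give different densities
   on this box of positive measure, and [D > 0] there. *)
pose Q : set (Rm * Rm) := `[0, 1[ `*` `]s1, s2[.
have mQ : measurable Q by exact: measurableX.
have QD : Q `<=` ~` [set x | cyl x -> (D x)%:E = 0%E].
  have p1 := pihalf_ge1 R.
  move=> [x t] [/= h1 h2].
  have /andP[x0 x1] : 0 <= (x : R) < 1 by move: h1; rewrite in_itv.
  have tt : a1 t != a2 t by apply: a12; move: h2; rewrite in_itv.
  apply/not_implyP; split.
    by split=> //=; rewrite /circle/= in_itv/= x0/=; lra.
  case; apply/eqP; rewrite gt_eqF//; apply: D_gt0.
  have cx : 0 < cos x by apply: cos_gt0_pihalf; apply/andP; split; lra.
  rewrite /cos_density/= (can_eq (addKr _)); apply: contraNN tt => /eqP.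
  by move=> /(mulIf (lt0r_neq0 cx)) ->.
have := negligibleS QD nD; rewrite negligibleP// => Q0.
have := product_measure1E leb leb (measurable_itv `[0, 1[%R) (measurable_itv `]s1, s2[%R).
rewrite [LHS]Q0 [X in (X * _)%E]lebesgue_measure_itv [X in (_ * X)%E]lebesgue_measure_itv/=.
rewrite !lte_fin ltr01 s12 -!EFinD -EFinM => -[] /eqP.
by rewrite subr0 mul1r eq_sym subr_eq0 gt_eqF.
Qed.

Lemma integral_entropy_cos_lt :
  (\int[leb2]_(x in cyl) entropy_integrand (cos_density a1) x <
   \int[leb2]_(x in cyl) entropy_integrand (cos_density a2) x)%E.
Proof.
have -> : (\int[leb2]_(x in cyl) entropy_integrand (cos_density a2) x =
    \int[leb2]_(x in cyl) ((e1 x)%:E + ((L x)%:E + (D x)%:E)))%E.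
  apply: eq_integral => x _; rewrite -!EFinD; congr EFin.
  by rewrite /D /e2 /e1; ring.
rewrite integralD//; last exact: integrableD.
rewrite integralD// integral_L add0e.
by rewrite [ltRHS]addeC lteDr//; exact: integrable_fin_num ie1.
Qed.

End Comparison.
End EntropyComparison.

(** * The two profiles *)

Section Truncation.
Context {R : realType}.
Local Notation Rm := (measurableTypeR R).
Local Notation leb := (@lebesgue_measure R).
Implicit Types A f F G : R -> R.

(** After time 0 the circle has been generated; [a = 0] continues with the uniform measure and hulls
    that grow concentrically. *)
Definition trunc A (t : R) : R := if t <= 0 then A t else 0.

Let N0 : set Rm := `]-oo, 0].

Let mN0 : measurable N0. Proof. exact: measurable_itv. Qed.

Lemma trunc_EFin A : EFin \o trunc A = (EFin \o A) \_ N0.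
Proof.
apply/funext => t; rewrite /trunc patchE mem_setE in_itv/=.
by case: ifP.
Qed.

Lemma measurable_trunc A : continuous A -> measurable_fun setT (trunc A : Rm -> Rm).
Proof.
move=> cA; apply/measurable_EFinP; rewrite trunc_EFin.
apply: (measurable_restrictT _ mN0).1; apply: measurable_funTS.
by apply: measurableT_comp => //; exact: continuous_measurable_fun.
Qed.

(** Only nonpositive times contribute, so the primitive freezes at 0; this is how the center stops
    once the curve is reached. *)
Lemma integral_trunc_itv f F (s t : R) : continuous f ->
  (forall x : R, is_derive x (1 : R) F (f x)) -> s <= t ->
  leb.-integrable `[s, t] (EFin \o trunc f) /\
  \int[leb]_(u in `[s, t]) trunc f u = F (Order.min t 0) - F (Order.min s 0).
Proof.
move=> cf dF st; have icf := continuous_integrable_itvcc s t cf; split.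
  rewrite trunc_EFin; apply/integrable_restrict => //.
  by apply: integrableS icf => //; exact: measurableI.
rewrite /Rintegral.
rewrite (_ : (fun x => _) = (EFin \o f) \_ N0); last by rewrite -trunc_EFin.
rewrite -integral_mkcondr.
have [s0|s0] := leP s 0.
  rewrite (_ : _ `&` _ = `[s, Order.min t 0]).
    by rewrite (ftc_itvcc _ dF cf) ?le_min ?st.
  apply/seteqP; split => x; rewrite /N0/= !in_itv/= le_min.
    by move=> [/andP[-> ->] ->].
  by move=> /andP[-> /andP[-> ->]].
rewrite (min_idPr (le_trans (ltW s0) st)) (_ : _ `&` _ = set0) ?integral_set0 ?subrr//.
rewrite -subset0 => x; rewrite /N0/= !in_itv/= => -[/andP[sx _] x0].
by have := le_trans sx x0; rewrite leNgt s0.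
Qed.

Lemma ge0_integral_trunc f F : continuous f -> (forall x, 0 <= f x) ->
  (forall x : R, is_derive x (1 : R) F (f x)) -> F t @[t --> -oo] --> (0 : R) ->
  (\int[leb]_t (trunc f t)%:E)%E = (F 0)%:E.
Proof.
move=> cf f0 dF F0.
(* Writing the endpoint as [- 0] fits the reflection [t -> - t], after which the improper integral
   runs to +oo. *)
transitivity (\int[leb]_(t in `]-oo, (- 0)%R]) (f t)%:E)%E.
  rewrite oppr0 [RHS]integral_mkcond; apply: eq_integral => t _.
  by rewrite -[LHS]/((EFin \o trunc f) t) trunc_EFin.
rewrite ge0_integration_by_substitutionNy//; last exact: continuous_subspaceT.
pose H x := - F (- x).
have dH (x : R) : is_derive x (1 : R) H (f (- x)).
  have dN : is_derive x (1 : R) (fun x : R => - x) (- 1 : R) by apply: is_derive_eq.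
  have d := @is_derive1_comp R F (fun x : R => - x) x _ _ (dF (- x)) dN.
  by apply: (is_derive_eq (is_deriveN d)); rewrite mulrN1 opprK.
have cH : continuous H.
  by move=> x; apply/differentiable_continuous/derivable1_diffP; have [] := dH x.
have cfN : continuous (f \o -%R).
  by move=> x; apply: continuous_comp; [exact: opp_continuous|exact: cf].
rewrite (@ge0_continuous_FTC2y _ _ H _ 0).
- by rewrite -EFinB sub0r /H opprK oppr0.
- by move=> x _; exact: f0.
- exact: continuous_subspaceT.
- have := (cvgNy_compNP F (nbhs (0 : R))).1 F0.
  rewrite -[X in _ -> _ --> X]oppr0 /H => h; exact: cvgN.
- by move=> x _; have [] := dH x.
- by apply: cvg_at_right_filter; exact: cH.
- by move=> x _; rewrite derive1E; have [_ ->] := dH x.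
Qed.

Lemma integrable_trunc f F : continuous f -> (forall x, 0 <= f x) ->
  (forall x : R, is_derive x (1 : R) F (f x)) -> F t @[t --> -oo] --> (0 : R) ->
  leb.-integrable setT (EFin \o (trunc f : Rm -> R)).
Proof.
move=> cf f0 dF F0; apply/integrableP; split.
  by apply/measurable_EFinP; exact: measurable_trunc.
rewrite (_ : (fun t => _) = (fun t => (trunc f t)%:E)).
  by rewrite (ge0_integral_trunc cf f0 dF F0) ltry.
by apply/funext => t; rewrite /= ger0_norm// /trunc; case: ifP.
Qed.

End Truncation.

Section TruncatedChain.
Context {R : realType}.
Local Notation Rm := (measurableTypeR R).
Variables A G : R -> R.
Hypothesis cA : continuous A.
Hypothesis dG : forall t : R, is_derive t (1 : R) G (A t * expR t).
Hypothesis G0 : G t @[t --> -oo] --> (0 : R).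

Lemma whole_plane_chain_trunc
    (mA : measurable_fun setT (trunc A : Rm -> Rm)) (A01 : forall t, 0 <= trunc A t <= 1) :
  whole_plane_chain (cos_measure mA A01)
    (affine_chain (fun t => G (Order.min t 0))).
Proof.
apply: whole_plane_chain_affine.
- move=> s t st.
  have cf : continuous (fun t => A t * expR t).
    by move=> x; apply: cvgM; [exact: cA|exact: continuous_expR].
  rewrite (_ : (fun u => _) = trunc (fun t => A t * expR t)); last first.
    by apply/funext => u; rewrite /trunc; case: ifP => // _; rewrite mul0r.
  exact: integral_trunc_itv cf dG st.
- apply: cvg_trans G0; apply: near_eq_cvg; near=> t.
  rewrite min_l//; near: t; apply: nbhs_ninfty_le; exact: num_real.
Unshelve. all: by end_near. Qed.

End TruncatedChain.

Section Profiles.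
Context {R : realType}.
Implicit Types t : R.

(** [2 beta / (1 + beta^2)] at [beta = l e^t]; [opt_center] is the primitive of this profile times
    [e^t] that vanishes at -oo. *)
Definition opt_profile (l t : R) : R :=
  2 * (l * expR t) / (1 + (l * expR t) ^+ 2).
Definition opt_center (l t : R) : R := ln (1 + (l * expR t) ^+ 2) / l.

(** Put [k = 1 - b^2]. Eliminating [r] between the radius [u = e^t = k r / (1 - b^2 r^2)] and the
    center [c = b r u] gives [b c^2 + k c = b u^2]. [eq_center] is its positive root, and
    [eq_profile] is [c' / e^t]. *)
Definition eq_profile (b t : R) : R :=
  2 * b * expR t / Num.sqrt ((1 - b ^+ 2) ^+ 2 + (2 * b * expR t) ^+ 2).
Definition eq_center (b t : R) : R :=
  (Num.sqrt ((1 - b ^+ 2) ^+ 2 + (2 * b * expR t) ^+ 2) - (1 - b ^+ 2)) / (2 * b).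

Lemma cvg_mulr_expR (r : R) : r * expR t @[t --> -oo] --> (0 : R).
Proof.
have cv : r * expR t @[t --> -oo] --> r * 0 by apply: cvgMl_tmp; exact: cvg_expR_Ny.
by rewrite mulr0 in cv.
Qed.

Lemma continuous_mulr_expR (r : R) : continuous (fun t => r * expR t).
Proof. by move=> x; apply: cvgMl_tmp; exact: continuous_expR. Qed.

Lemma is_derive_mulr_expR (r t : R) : is_derive t (1 : R) (fun t => r * expR t) (r * expR t).
Proof. by apply: is_derive_eq; rewrite /GRing.scale/=; ring. Qed.

Lemma two_div_mono (x y : R) : 0 <= x -> x <= y -> y <= 1 ->
  2 * x / (1 + x ^+ 2) <= 2 * y / (1 + y ^+ 2).
Proof.
move=> x0 xy y1.
rewrite ler_pdivrMr ?ltr_pwDl ?sqr_ge0// mulrAC ler_pdivlMr ?ltr_pwDl ?sqr_ge0//.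
rewrite -subr_ge0.
have -> : 2 * y * (1 + x ^+ 2) - 2 * x * (1 + y ^+ 2) = 2 * ((y - x) * (1 - x * y)) by ring.
by rewrite mulr_ge0// mulr_ge0//; nra.
Qed.

Section Opt.
Variable l : R.
Hypothesis l01 : 0 < l < 1.
Let l0 : 0 < l. Proof. by case/andP: l01. Qed.
Let l1 : l < 1. Proof. by case/andP: l01. Qed.
Let D t := 1 + (l * expR t) ^+ 2.
Let DE : D = fun t => 1 + (l * expR t) * (l * expR t).
Proof. by apply/funext => t; rewrite /D expr2. Qed.

Let D0 t : 0 < D t. Proof. by rewrite /D ltr_pwDl ?sqr_ge0. Qed.

Let cD : continuous D.
Proof.
rewrite DE => t; apply: cvgD; first exact: cvg_cst.
by apply: cvgM; exact: continuous_mulr_expR.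
Qed.

Lemma continuous_opt_profile : continuous (opt_profile l).
Proof.
move=> t; apply: cvgM; first by apply: cvgMl_tmp; exact: continuous_mulr_expR.
by apply: cvgV; [rewrite gt_eqF// D0|exact: cD].
Qed.

Lemma is_derive_opt_center t :
  is_derive t (1 : R) (opt_center l) (opt_profile l t * expR t).
Proof.
have dD : is_derive t (1 : R) D (2 * (l * expR t) * (l * expR t)).
  have d := is_derive_mulr_expR l t.
  by rewrite DE; apply: is_derive_eq; rewrite /GRing.scale/=; ring.
have dl := @is_derive1_comp R (@ln R) D t _ _ (is_derive1_ln (D0 t)) dD.
have dc : is_derive t (1 : R) (fun t => l^-1 * ln (D t))
    (l^-1 * ((D t)^-1 * (2 * (l * expR t) * (l * expR t)))).
  exact: (is_deriveZ l^-1 dl).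
rewrite (_ : opt_center l = (fun t => l^-1 * ln (D t))); last first.
  by apply/funext => u; rewrite /opt_center mulrC.
apply: (is_derive_eq dc); rewrite /opt_profile -/(D t).
by field; rewrite !gt_eqF.
Qed.

Lemma cvg_opt_center : opt_center l t @[t --> -oo] --> (0 : R).
Proof.
have cvD : D t @[t --> -oo] --> (1 : R).
  have cv : D t @[t --> -oo] --> (1 + 0 * 0 : R).
    by rewrite DE; apply: cvgD; [exact: cvg_cst|apply: cvgM; exact: cvg_mulr_expR].
  by rewrite mulr0 addr0 in cv.
have cv : ln (D t) * l^-1 @[t --> -oo] --> ln 1 * l^-1.
  by apply: cvgMr_tmp; apply: continuous_cvg cvD; apply: continuous_ln.
by rewrite ln1 mul0r in cv.
Qed.

Lemma opt_profile_bound t : t <= 0 -> 0 <= opt_profile l t <= 2 * l / (1 + l ^+ 2).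
Proof.
move=> t0; have e1 : expR t <= 1 by rewrite -expR0 ler_expR.
have le0 : 0 <= l * expR t by rewrite mulr_ge0 ?expR_ge0// ltW.
apply/andP; split; first by rewrite /opt_profile divr_ge0 ?mulr_ge0// ltW// D0.
by apply: two_div_mono => //; [rewrite ger_pMr|exact: ltW].
Qed.

Lemma opt_profile_le t : opt_profile l t <= 2 * expR t.
Proof.
rewrite /opt_profile ler_pdivrMr; last exact: D0.
apply: (@le_trans _ _ (2 * expR t)).
  by rewrite ler_wpM2l// ler_piMl ?expR_ge0// ltW.
by rewrite ler_peMr ?mulr_ge0 ?expR_ge0// lerDl sqr_ge0.
Qed.

End Opt.

Section Eq.
Variable b : R.
Hypothesis b01 : 0 < b < 1.
Let b0 : 0 < b. Proof. by case/andP: b01. Qed.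
Let b1 : b < 1. Proof. by case/andP: b01. Qed.
Let k := 1 - b ^+ 2.
Let k0 : 0 < k. Proof. by rewrite subr_gt0 expr_lt1// ltW. Qed.
Let D t := k ^+ 2 + (2 * b * expR t) ^+ 2.
Let DE : D = fun t => k ^+ 2 + (2 * b * expR t) * (2 * b * expR t).
Proof. by apply/funext => t; rewrite /D (expr2 (2 * b * _)). Qed.

Let D0 t : 0 < D t. Proof. by rewrite ltr_pwDl ?sqr_ge0// exprn_gt0. Qed.
Let S0 t : 0 < Num.sqrt (D t). Proof. by rewrite sqrtr_gt0. Qed.

Let cD : continuous D.
Proof.
rewrite DE => t; apply: cvgD; first exact: cvg_cst.
by apply: cvgM; exact: continuous_mulr_expR.
Qed.

Let cS : continuous (fun t => Num.sqrt (D t)).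
Proof. by move=> t; apply: continuous_comp; [exact: cD|exact: sqrt_continuous]. Qed.

Lemma continuous_eq_profile : continuous (eq_profile b).
Proof.
move=> t; apply: cvgM; first exact: continuous_mulr_expR.
by apply: cvgV; [rewrite gt_eqF// S0|exact: cS].
Qed.

Lemma is_derive_eq_center t :
  is_derive t (1 : R) (eq_center b) (eq_profile b t * expR t).
Proof.
have dD : is_derive t (1 : R) D (2 * (2 * b * expR t) * (2 * b * expR t)).
  have d := is_derive_mulr_expR (2 * b) t.
  by rewrite DE; apply: is_derive_eq; rewrite /GRing.scale/=; ring.
have dS := @is_derive1_comp R (@Num.sqrt R) D t _ _ (is_derive1_sqrt (D0 t)) dD.
have dc := is_deriveZ (2 * b)^-1 (is_deriveB dS (is_derive_cst k t 1)).
rewrite (_ : eq_center b = (2 * b)^-1 \*: ((@Num.sqrt R \o D) - cst k)); last first.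
  by apply/funext => u; rewrite /eq_center mulrC.
apply: (is_derive_eq dc); rewrite /eq_profile -/(D t) /GRing.scale/= subr0.
by field; rewrite !gt_eqF.
Qed.

Lemma cvg_eq_center : eq_center b t @[t --> -oo] --> (0 : R).
Proof.
have cvD : D t @[t --> -oo] --> (k ^+ 2 : R).
  have cv : D t @[t --> -oo] --> (k ^+ 2 + 0 * 0 : R).
    by rewrite DE; apply: cvgD; [exact: cvg_cst|apply: cvgM; exact: cvg_mulr_expR].
  by rewrite mulr0 addr0 in cv.
have cv : (Num.sqrt (D t) - k) * (2 * b)^-1 @[t --> -oo] -->
    (Num.sqrt (k ^+ 2) - k) * (2 * b)^-1.
  apply: cvgMr_tmp; apply: cvgB; last exact: cvg_cst.
  by apply: continuous_cvg cvD; exact: sqrt_continuous.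
by rewrite sqrtr_sqr gtr0_norm// subrr mul0r in cv.
Qed.

Lemma eq_profile_le t : eq_profile b t <= 2 / k * expR t.
Proof.
rewrite /eq_profile -/k -/(D t) ler_pdivrMr// [leRHS]mulrAC.
rewrite ler_wpM2r ?expR_ge0// [leRHS]mulrAC ler_pdivlMr// -mulrA ler_pM2l//.
apply: (@le_trans _ _ k); first by rewrite ler_piMl// ltW.
by rewrite -[leLHS](gtr0_norm k0) -sqrtr_sqr ler_sqrt ?(ltW (D0 t))// /D lerDl sqr_ge0.
Qed.

Lemma eq_profile_bound t : t <= 0 -> 0 <= eq_profile b t <= 2 * b / (1 + b ^+ 2).
Proof.
move=> t0; have e1 : expR t <= 1 by rewrite -expR0 ler_expR.
apply/andP; split.
  by rewrite divr_ge0 ?mulr_ge0 ?expR_ge0 ?sqrtr_ge0// ltW.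
have u0 := expR_gt0 t; rewrite /eq_profile -/k -/(D t) ler_pdivrMr//.
have b2 : 0 < 1 + b ^+ 2 by rewrite ltr_pwDl ?sqr_ge0.
(* Equality holds at time 0; the difference of the squares is [(1 - b^2)^2 (1 - e^{2t})]. *)
have key : expR t * (1 + b ^+ 2) <= Num.sqrt (D t).
  rewrite -ler_sqr ?nnegrE ?sqrtr_ge0 ?mulr_ge0 ?(ltW u0) ?(ltW b2)// sqr_sqrtr ?(ltW (D0 t))//.
  rewrite /D /k; have : 0 <= (1 - b ^+ 2) ^+ 2 * (1 - expR t ^+ 2).
    by rewrite mulr_ge0 ?sqr_ge0// subr_ge0 exprn_ile1// ltW.
  by move: (expR t) => u; lra.
rewrite -subr_ge0.
have -> : 2 * b / (1 + b ^+ 2) * Num.sqrt (D t) - 2 * b * expR t =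
    2 * b / (1 + b ^+ 2) * (Num.sqrt (D t) - expR t * (1 + b ^+ 2)).
  by field; rewrite gt_eqF.
by rewrite mulr_ge0 ?subr_ge0// divr_ge0 ?(ltW b2)// mulr_ge0// ltW.
Qed.

Lemma eq_center_quadratic t :
  b * eq_center b t ^+ 2 + k * eq_center b t = b * expR t ^+ 2.
Proof.
have : Num.sqrt (D t) ^+ 2 = D t by rewrite sqr_sqrtr// ltW.
rewrite /eq_center -/(D t) -/k; move: (Num.sqrt _) => s sE.
have -> : b * expR t ^+ 2 = (s ^+ 2 - k ^+ 2) / (4 * b).
  by rewrite sE /D; field; rewrite gt_eqF.
by field; rewrite gt_eqF.
Qed.

Lemma eq_center_gt0 t : 0 < eq_center b t.
Proof.
rewrite /eq_center divr_gt0 ?mulr_gt0// subr_gt0 -/k.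
rewrite -[X in X < _](gtr0_norm k0) -sqrtr_sqr ltr_sqrt ?(D0 t)//.
by rewrite ltrDl exprn_gt0// !mulr_gt0// expR_gt0.
Qed.

(** Two distinct solutions would satisfy [b (x + c) + k = 0], impossible for [x > 0] and
    [c >= 0]. *)
Lemma eq_center_unique t c : 0 <= c -> b * c ^+ 2 + k * c = b * expR t ^+ 2 ->
  eq_center b t = c.
Proof.
move=> c0 e; have := eq_center_quadratic t; have := eq_center_gt0 t; rewrite -e.
move: (eq_center b t) => x x0 /eqP; rewrite -subr_eq0.
have -> : b * x ^+ 2 + k * x - (b * c ^+ 2 + k * c) = (x - c) * (b * (x + c) + k) by ring.
rewrite mulf_eq0 subr_eq0 => /orP[/eqP//|/eqP h].
have : 0 < b * (x + c) by rewrite mulr_gt0// ltr_pwDl.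
by move: h k0 => h ? ?; lra.
Qed.

End Eq.

End Profiles.

(** * The off-center circle and its two driving measures *)

Section OffCenterCircle.
Context {R : realType}.
Local Notation C := (Cplx R).
Local Notation Rm := (measurableTypeR R).
Local Notation leb := (@lebesgue_measure R).

Variable l : R.
Hypothesis l01 : 0 < l < 1.
Let l0 : 0 < l. Proof. by case/andP: l01. Qed.
Let l1 : l < 1. Proof. by case/andP: l01. Qed.

Definition circle_center : R := ln (1 + l ^+ 2) / l.
Local Notation b := circle_center.
Definition circle_curve : set C := [set z | sqdist b z = 1].
Local Notation gamma := circle_curve.

(** [ln (1 + v) < v] at [v = l^2]. Strictness separates the profiles at time 0, and the inequality
    lets one bound [m] serve both. *)
Lemma circle_center_lt : b < l.
Proof.
rewrite /b ltr_pdivrMr// -expr2.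
have e0 : l ^+ 2 != 0 by rewrite expf_neq0// gt_eqF.
by rewrite -ltr_expR lnK ?posrE ?ltr_pwDl ?sqr_ge0//; exact: expR_gt1Dx.
Qed.

Lemma circle_center01 : 0 < b < 1.
Proof.
rewrite (lt_trans circle_center_lt l1) andbT divr_gt0//.
by rewrite ln_gt0// ltrDl exprn_gt0.
Qed.

Let b01 := circle_center01.
Let b0 : 0 < b. Proof. by case/andP: b01. Qed.
Let b1 : b < 1. Proof. by case/andP: b01. Qed.
Let k := 1 - b ^+ 2.
Let k0 : 0 < k. Proof. by rewrite subr_gt0 expr_lt1// ltW. Qed.

Let inner : inner_domain gamma = [set z | sqdist b z < 1].
Proof. by apply: inner_domain_circle; rewrite expr_lt1// ltW. Qed.

Let closed_inner : closure (inner_domain gamma) = [set z | sqdist b z <= 1].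
Proof. by rewrite inner closure_disc. Qed.

Lemma separates_circle : separates_0_infty gamma.
Proof.
split.
  rewrite /gamma/= /sqdist/= sub0r sqrrN expr0n addr0 => h.
  by have : b ^+ 2 < 1 by [rewrite expr_lt1// ltW]; rewrite h ltxx.
rewrite inner; exists 2%:C; split; first by apply/complex_realP; exists 2.
move=> M M2 z /= zb; apply: le_trans (ltW M2); rewrite (@lec_normP R z 2)//.
move: zb; rewrite /sqdist; move: (complex.Re z) (complex.Im z) => x y h.
have xb : x - b < 1.
  rewrite ltNge; apply/negP => h1.
  have : 1 <= (x - b) ^+ 2 by rewrite exprn_ege1.
  have := sqr_ge0 y; lra.
have : b * (x - b) < b * 1 by rewrite ltr_pM2l.
have : b ^+ 2 < 1 by rewrite expr_lt1// ltW.
by move: b1; lra.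
Qed.

Let c1 (t : R) := opt_center l (Order.min t 0).
Let c2 (t : R) := eq_center b (Order.min t 0).

Let opt_center0 : opt_center l 0 = b.
Proof. by rewrite /opt_center expR0 mulr1. Qed.

Let eq_center0 : eq_center b 0 = b.
Proof. by apply: (eq_center_unique b01 (ltW b0)); rewrite expR0; ring. Qed.

Let hullE (c : R -> R) (t : R) : hull (affine_chain c t) = [set z | sqdist (c t) z <= expR t ^+ 2].
Proof. by rewrite /affine_chain hull_affine// expR_gt0. Qed.

Lemma hull_capacity : exterior_map 1 (closure (inner_domain gamma)) (affine 1 b).
Proof.
have := @exterior_map_affine R 1 b ltr01.
by rewrite hull_affine// expr1n closed_inner.
Qed.

Lemma generates_circle (rho : {measure set (Rm * Rm) -> \bar R}) c :
  c 0 = b -> whole_plane_chain rho (affine_chain c) -> generates rho gamma.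
Proof.
move=> cb ch; exists 0, (affine_chain c); split => //.
  by exists (affine 1 b); rewrite expR0; exact: hull_capacity.
rewrite /affine_chain affine_exterior ?expR_gt0// expR0 expr1n cb.
exact: exterior_boundary.
Qed.

Lemma interior_uniformization_circle :
  interior_uniformization gamma (moebius k b).
Proof.
split; first by rewrite inner; exact: moebius_conformal.
  by rewrite /moebius mulr0 mul0r.
have d0 : 1 - b%:C * 0 != 0 :> R[i] by rewrite mulr0 subr0 oner_eq0.
have [_ ->] := is_derive_moebius k d0.
rewrite mulr0 subr0 expr1n divr1 (_ : 0 = 0%:C)// ltcR; exact: k0.
Qed.

Lemma equipotential_hulls_circle :
  range (fun t => hull (affine_chain c2 t)) =
  equipotential_hulls gamma (moebius k b) (affine 1 b).
Proof.
have hyper r : 0 < r -> ~` (affine 1 b @` [set z : C | r%:C < `|z|]) =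
    [set z | sqdist b z <= r ^+ 2].
  move=> r0; rewrite (_ : mkset _ = [set z | r ^+ 2 < sqdist 0 z]).
    rewrite affine_sqdist_gt// expr1n mul1r.
    by apply/seteqP; split => z /=; rewrite leNgt => /negP.
  by apply/seteqP; split => z /=; rewrite /sqdist subr0 gtc_normP// ltW.
have brpos r : 0 < r -> r < 1 -> 0 < 1 - b ^+ 2 * r ^+ 2.
  move=> r0 r1; have br0 : 0 <= b * r by rewrite mulr_ge0// ltW.
  by rewrite -exprMn subr_gt0 expr_lt1// mulr_ilt1// ltW.
(* A radius equal to that of the image of [|z| <= r] forces the center [b r e^t], by uniqueness of
   the nonnegative root. *)
have ell t r : 0 < r < 1 -> expR t = k * r / (1 - b ^+ 2 * r ^+ 2) ->
    hull (affine_chain c2 t) = moebius k b @` [set z : C | `|z| <= r%:C].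
  move=> /andP[r0 r1] tE.
  have br : 0 < 1 - b ^+ 2 * r ^+ 2.
    exact: brpos.
  have t0 : t <= 0.
    rewrite -ler_expR expR0 tE ler_pdivrMr// mul1r -subr_ge0.
    have -> : 1 - b ^+ 2 * r ^+ 2 - k * r = (1 - r) * (1 + b ^+ 2 * r) by rewrite /k; ring.
    rewrite mulr_ge0 ?subr_ge0 ?(ltW r1)// addr_ge0// mulr_ge0 ?sqr_ge0//.
    exact: ltW.
  rewrite hullE (moebius_closed_disc b01) ?r0 ?(ltW r1)// /c2 min_l//.
  have bu0 : 0 <= b * r * expR t by rewrite mulr_ge0 ?expR_ge0// mulr_ge0// ltW.
  rewrite -/k -tE (eq_center_unique b01 bu0)// tE /k.
  by field; rewrite exprMn gt_eqF.
apply/seteqP; split => K.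
  move=> [t _ <-]; have [t0|t0|t0] := ltgtP t 0.
  (* Solved from the center [b r e^t]; the quadratic relation then yields the radius relation
     [uE]. *)
  - pose r := eq_center b t / (b * expR t).
    have u0 := expR_gt0 t; have g0 := eq_center_gt0 b01 t.
    have q := eq_center_quadratic b01 t; rewrite -/k in q.
    have r0 : 0 < r by rewrite divr_gt0// mulr_gt0.
    have gE : eq_center b t = b * r * expR t.
      by rewrite /r; field; rewrite !gt_eqF.
    have uE : expR t * (1 - b ^+ 2 * r ^+ 2) = k * r.
      have bu : b * expR t != 0 by rewrite mulf_neq0 ?gt_eqF.
      apply: (mulfI bu); move: q; rewrite gE; lra.
    have br : 0 < 1 - b ^+ 2 * r ^+ 2.
      by rewrite -(pmulr_rgt0 _ u0) uE mulr_gt0.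
    (* A value [r >= 1] would make the radius at least 1, whereas [e^t < 1] here. *)
    have r1 : r < 1.
      rewrite ltNge; apply/negP => r1.
      have u1 : expR t < 1 by rewrite -expR0 ltr_expR.
      have : expR t * (1 - b ^+ 2 * r ^+ 2) < 1 - b ^+ 2 * r ^+ 2 by rewrite gtr_pMl.
      rewrite uE; apply/negP; rewrite -leNgt.
      apply: (@le_trans _ _ k); last by rewrite ler_peMr// ltW.
      by rewrite lerD2l lerN2 ler_peMr ?sqr_ge0// exprn_ege1.
    apply: Or31; exists r; first by rewrite r0.
    by apply: ell; rewrite ?r0// -uE mulfK// gt_eqF.
  - apply: Or33; exists (expR t); first by rewrite expR_gt1.
    by rewrite hullE hyper ?expR_gt0// /c2 min_r ?eq_center0// ltW.
  - apply: Or32; rewrite closed_inner hullE t0 expR0 expr1n /c2 min_l//.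
    by rewrite eq_center0.
case=> [[r r01 ->]|->|[r r1 ->]].
- case/andP: (r01) => r0 r1.
  have u0 : 0 < k * r / (1 - b ^+ 2 * r ^+ 2).
    by rewrite divr_gt0 ?mulr_gt0// brpos.
  exists (ln (k * r / (1 - b ^+ 2 * r ^+ 2))) => //; apply: ell => //.
  by rewrite lnK.
- by exists 0 => //; rewrite closed_inner hullE expR0 expr1n /c2 min_l// eq_center0.
- have r0 : 0 < r := lt_trans ltr01 r1.
  exists (ln r) => //; rewrite hullE hyper// lnK ?posrE// /c2 min_r ?eq_center0//.
  exact: ln_ge0 (ltW r1).
Qed.

Let m := 2 * l / (1 + l ^+ 2).

Let m1 : m < 1.
Proof.
rewrite /m ltr_pdivrMr ?ltr_pwDl ?sqr_ge0// mul1r.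
have : 0 < (1 - l) ^+ 2 by rewrite exprn_gt0// subr_gt0.
lra.
Qed.

Let m0 : 0 <= m.
Proof. by rewrite divr_ge0 ?mulr_ge0 ?addr_ge0 ?sqr_ge0// ltW. Qed.

Let a1 := trunc (opt_profile l).
Let a2 := trunc (eq_profile b).

Let am1 t : 0 <= a1 t <= m.
Proof.
rewrite /a1 /trunc; case: ifP => [t0|_]; last by rewrite lexx m0.
exact: opt_profile_bound.
Qed.

Let am2 t : 0 <= a2 t <= m.
Proof.
rewrite /a2 /trunc; case: ifP => [t0|_]; last by rewrite lexx m0.
have /andP[-> h] := eq_profile_bound b01 t0.
by rewrite (le_trans h)// two_div_mono// ltW// circle_center_lt.
Qed.

Let a01 (a : R -> R) : (forall t, 0 <= a t <= m) -> forall t, 0 <= a t <= 1.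
Proof. by move=> am t; have /andP[-> /le_trans] := am t; apply; exact: ltW. Qed.

Let ma1 : measurable_fun setT (a1 : Rm -> Rm).
Proof. by apply: measurable_trunc; exact: continuous_opt_profile. Qed.

Let ma2 : measurable_fun setT (a2 : Rm -> Rm).
Proof. by apply: measurable_trunc; exact: continuous_eq_profile. Qed.

Let a1_01 := a01 am1.
Let a2_01 := a01 am2.

Definition opt_measure := cos_measure ma1 a1_01.
Definition equipotential_circle_measure := cos_measure ma2 a2_01.

Lemma opt_measure_generates :
  loewner_class opt_measure /\ generates opt_measure gamma.
Proof.
split; first exact: loewner_class_cos_measure.
apply: (@generates_circle _ c1); first by rewrite /c1 min_l.
apply: whole_plane_chain_trunc.
- exact: continuous_opt_profile.
- exact: is_derive_opt_center.
- exact: cvg_opt_center.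
Qed.

Lemma equipotential_measure_circle :
  equipotential_measure gamma equipotential_circle_measure.
Proof.
split; first exact: loewner_class_cos_measure.
exists (moebius k b), (affine 1 b), (affine_chain c2); split.
- exact: interior_uniformization_circle.
- by exists 1; exact: hull_capacity.
- apply: whole_plane_chain_trunc.
  + exact: continuous_eq_profile.
  + exact: is_derive_eq_center.
  + exact: cvg_eq_center.
- exact: equipotential_hulls_circle.
Qed.

Let beta := trunc (fun t => l * expR t).
(** As [k <= 1], this majorant of the equipotential profile also dominates the bound [2 e^t] on the
    optimal one. *)
Let bound := trunc (fun t => 2 / k * expR t).

Let ibound : leb.-integrable setT (EFin \o (bound : Rm -> R)).
Proof.
apply: (@integrable_trunc _ _ (fun t => 2 / k * expR t)).
- exact: continuous_mulr_expR.
- by move=> x; rewrite mulr_ge0 ?expR_ge0// divr_ge0// ltW.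
- exact: cvg_mulr_expR.
Qed.

Let a1_bound t : a1 t <= bound t.
Proof.
rewrite /a1 /bound /trunc; case: ifP => // t0.
apply: (le_trans (opt_profile_le l01 t)); rewrite ler_wpM2r ?expR_ge0//.
by rewrite ler_pdivlMr// ler_piMr// /k lerBlDr lerDl sqr_ge0.
Qed.

Let a2_bound t : a2 t <= bound t.
Proof.
rewrite /a2 /bound /trunc; case: ifP => // t0.
exact: eq_profile_le.
Qed.

Let beta01 t : 0 <= beta t < 1.
Proof.
rewrite /beta /trunc; case: ifP => t0; last by rewrite lexx ltr01.
have e1 : expR t <= 1 by rewrite -expR0 ler_expR.
rewrite mulr_ge0 ?expR_ge0 ?(ltW l0)//=.
by apply: le_lt_trans l1; rewrite ger_pMr.
Qed.

Let a1E t : a1 t = 2 * beta t / (1 + beta t ^+ 2).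
Proof. by rewrite /a1 /beta /trunc; case: ifP => // _; rewrite mulr0 mul0r. Qed.

(** The integrand is the speed of the center, so its total is the distance travelled from 0 up to
    time 0. *)
Let moment (A G : R -> R) : continuous A -> (forall t, 0 <= A t) ->
  (forall t : R, is_derive t (1 : R) G (A t * expR t)) ->
  G t @[t --> -oo] --> (0 : R) ->
  leb.-integrable setT (EFin \o (trunc (fun t => A t * expR t) : Rm -> R)) /\
  (\int[leb]_t (trunc (fun t => A t * expR t) t)%:E = (G 0)%:E)%E.
Proof.
move=> cA A0 dG G0.
have cAe : continuous (fun t => A t * expR t).
  by move=> x; apply: cvgM; [exact: cA|exact: continuous_expR].
have Ae0 t : 0 <= A t * expR t by rewrite mulr_ge0 ?expR_ge0.
by split; [exact: integrable_trunc dG G0|exact: ge0_integral_trunc].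
Qed.

Let opt_ge0 t : 0 <= opt_profile l t.
Proof. by rewrite divr_ge0 ?mulr_ge0 ?addr_ge0 ?expR_ge0 ?sqr_ge0// ltW. Qed.

Let eq_ge0 t : 0 <= eq_profile b t.
Proof. by rewrite /eq_profile divr_ge0 ?sqrtr_ge0// mulr_ge0 ?expR_ge0// mulr_ge0// ltW. Qed.

(* Both centers run from 0 to b, so the two profiles have the same moment. *)
Let orth : (\int[leb]_t ((a2 t - a1 t) * beta t)%:E = 0)%E.
Proof.
have [i1 e1] := moment (continuous_opt_profile (l := l)) opt_ge0
  (is_derive_opt_center l01) (@cvg_opt_center R l).
have [i2 e2] := moment (continuous_eq_profile b01) eq_ge0
  (is_derive_eq_center b01) (cvg_eq_center b01).
rewrite opt_center0 in e1; rewrite eq_center0 in e2.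
transitivity (\int[leb]_t (l%:E * ((trunc (fun t => eq_profile b t * expR t) t)%:E -
    (trunc (fun t => opt_profile l t * expR t) t)%:E)))%E.
  apply: eq_integral => t _; rewrite -EFinB -EFinM; congr EFin.
  by rewrite /a1 /a2 /beta /trunc; case: ifP => _; ring.
rewrite integralZl//; last exact: integrableB.
by rewrite integralB// e1 e2 subee// mule0.
Qed.

(** At time 0 the first profile is [2 l / (1 + l^2)] and the second at most [2 b / (1 + b^2)],
    smaller as [b < l]; continuity extends the gap to an interval before 0. *)
Let profiles_neq : exists2 s, s < 0 & forall t, s < t < 0 -> a1 t != a2 t.
Proof.
pose h t := opt_profile l t - eq_profile b t.
have h0 : 0 < h 0.
  rewrite subr_gt0 (@le_lt_trans _ _ (2 * b / (1 + b ^+ 2)))//.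
    by have /andP[] := eq_profile_bound b01 (lexx 0).
  rewrite /opt_profile expR0 mulr1.
  rewrite ltr_pdivrMr ?ltr_pwDl ?sqr_ge0// mulrAC ltr_pdivlMr ?ltr_pwDl ?sqr_ge0//.
  rewrite -subr_gt0.
  have -> : 2 * l * (1 + b ^+ 2) - 2 * b * (1 + l ^+ 2) = 2 * ((l - b) * (1 - b * l)) by ring.
  by rewrite mulr_gt0// mulr_gt0// ?subr_gt0 ?circle_center_lt// mulr_ilt1// ltW.
have ch : h t @[t --> (0 : R)] --> h 0.
  by apply: cvgB; [exact: continuous_opt_profile|exact: continuous_eq_profile].
have [e /= e0 he] := (nbhs_ballP _ _).1 (cvgr_gt _ ch _ h0).
exists (- e); first by rewrite oppr_lt0.
move=> t /andP[et t0]; rewrite /a1 /a2 /trunc (ltW t0) gt_eqF// -subr_gt0.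
by apply: he; rewrite /ball/= sub0r normrN ltr0_norm//; lra.
Qed.

Lemma entropy_lt :
  (entropy opt_measure < entropy equipotential_circle_measure)%E.
Proof.
have [s s0 ne] := profiles_neq.
have p2 : (0 : R) < 2 * pi by rewrite mulr_gt0// pi_gt0.
have lt := integral_entropy_cos_lt ma1 ma2 (measurable_trunc (@continuous_mulr_expR R l)) m1 am1 am2
  a1_bound a2_bound ibound beta01 a1E orth s0 ne.
(* [entropyE] asks for bounded densities: [1 + a cos] is at most 2. *)
have d2 (a : R -> R) : (forall t, 0 <= a t <= 1) -> forall x, cos_density a x <= 2.
  move=> ha x; have /andP[x0 x1] := ha x.2; rewrite /cos_density.
  have := cos_le1 x.1; have := cos_geN1 x.1; nra.
rewrite (entropyE (is_density_cos_measure ma1 a1_01) (d2 _ a1_01)); last first.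
  exact: integrable_entropy_cos ma1 m1 am1 a1_bound ibound.
rewrite (entropyE (is_density_cos_measure ma2 a2_01) (d2 _ a2_01)); last first.
  exact: integrable_entropy_cos ma2 m1 am2 a2_bound ibound.
by rewrite lte_pmul2l// lte_fin invr_gt0.
Qed.

End OffCenterCircle.

Theorem proposition5p4 (R : realType) :
  exists gamma : set (Cplx R),
    [/\ jordan_curve gamma,
        separates_0_infty gamma
      & exists rho_eq :
          {measure set (measurableTypeR R * measurableTypeR R) -> \bar R},
          equipotential_measure gamma rho_eq /\
          (minimal_entropy gamma < entropy rho_eq)%E].
Proof.
(* Any [l] strictly between 0 and 1 gives such a circle. *)
have hl : 0 < (1 / 2 : R) < 1 by lra.
exists (circle_curve (1 / 2)); split.
- exact: jordan_circle.
- exact: separates_circle.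
- exists (equipotential_circle_measure hl); split.
    exact: equipotential_measure_circle.
  (* The measure of the optimal profile is one of the competitors, so the infimum is at most its
     entropy. *)
  apply: le_lt_trans (entropy_lt hl).
  apply: ereal_inf_lbound; exists (opt_measure hl) => //.
  exact: opt_measure_generates.
Qed.
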